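(* Let $k$ be a number field and let $1\le r<N$ be integers. For every $c\in\mathrm{Cl}(k)$, the fiber $\Psi_{r,N}^{-1}(c)$ satisfies weak approximation on $\mathrm{Gr}(r,N)$. That is: for every $c\in\mathrm{Cl}(k)$, every finite set $S$ of places of $k$, and every choice of non-empty open subsets $\mathcal{U}_v\subset\mathrm{Gr}(r,N)(k_v)$ for $v\in S$, there exists $W\in\mathrm{Gr}(r,N)(k)$ such that $\Psi_{r,N}(W)=c$ and $W\in\mathcal{U}_v$ for all $v\in S$.
   Context: $\mathcal{O}_k$ is the ring of integers of $k$ and $\mathrm{Cl}(k)$ is its ideal class group. Places of $k$ may be finite or infinite; $k_v$ is the completion of $k$ at $v$. $\mathrm{Gr}(r,N)$ is the Grassmannian over $k$ parametrizing $r$-dimensional linear subspaces of $k^N$; $\mathrm{Gr}(r,N)(k_v)$, the set of $r$-dimensional $k_v$-subspaces of $k_v^N$, carries the $v$-adic topology. For $W\in\mathrm{Gr}(r,N)(k)$ with $k$-basis $w_1,\ldots,w_r$, write $w_1\wedge\cdots\wedge w_r=\sum_I q_I e_I$ in $\bigwedge^r k^N$, where $e_1,\ldots,e_N$ is the standard basis, $I=\{i_1<\cdots<i_r\}$ runs over the $r$-element subsets of $\{1,\ldots,N\}$ and $e_I=e_{i_1}\wedge\cdots\wedge e_{i_r}$. The map $\Psi_{r,N}:\mathrm{Gr}(r,N)(k)\to\mathrm{Cl}(k)$ is defined by $\Psi_{r,N}(W)=\left[\sum_I q_I\mathcal{O}_k\right]$, the class of the fractional ideal generated by the Plücker coordinates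 of $W$ (independent of the choice of basis). Equivalently, $\Psi_{r,N}$ is the Plücker embedding $W\mapsto[w_1\wedge\cdots\wedge w_r]$ into $\mathbb{P}(\bigwedge^r k^N)$ followed by the map sending a projective point to the ideal class generated by its homogeneous coordinates. *)

(* Defs.v *)
From HB Require Import structures.
From mathcomp Require Import all_boot all_order all_algebra all_field.
From mathcomp Require Import all_classical all_reals all_analysis.
From mathcomp Require Import zify.

Set Implicit Arguments.
Unset Strict Implicit.
Unset Printing Implicit Defensive.
Import Order.TTheory GRing.Theory Num.Theory.
Local Open Scope classical_set_scope.
Local Open Scope quotient_scope.
Local Open Scope ring_scope.

Section IdealClasses.
Variable k : fieldExtType rat.

Definition ring_of_integers : set k :=
  [set x | integralOver (intr : int -> k) x].

Definition ideal_gen (I : finType) (q : I -> k) : set k :=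
  [set x | exists2 c : I -> k,
    (forall i, ring_of_integers (c i)) & x = \sum_i c i * q i].

Definition is_fractional (A : set k) : Prop :=
  (exists (I : finType) (q : I -> k), A = ideal_gen q) /\
  (exists2 x, A x & x != 0).

Definition frac_ideal : Type := {A : set k | `[< is_fractional A >]}.
HB.instance Definition _ := Choice.on frac_ideal.

Definition ideal_equiv (A B : frac_ideal) : bool :=
  `[< exists2 a : k, a != 0 & val B = [set a * x | x in val A] >].

Lemma ideal_equiv_equiv : equiv_class_of ideal_equiv.
Proof.
split=> [A|A B|B A C].
- apply/asboolP; exists 1; first exact: oner_neq0.
  by apply/seteqP; split=> [x Ax|_ [x Ax <-]]; [exists x|]; rewrite ?mul1r.
- have aux C D : ideal_equiv C D -> ideal_equiv D C.
    move=> /asboolP [a a0 DE]; apply/asboolP; exists a^-1; rewrite ?invr_eq0//.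
    rewrite DE image_comp; apply/seteqP; split=> [x Cx|_ [x Cx <-]] /=.
      by exists x => //=; rewrite mulKf.
    by rewrite mulKf.
  by apply/idP/idP; exact: aux.
- move=> /asboolP [a a0 BE] /asboolP [b b0 CE]; apply/asboolP.
  exists (b * a); rewrite ?mulf_neq0// CE BE image_comp.
  by apply/seteqP; split=> _ [x Ax <-]; exists x => //=; rewrite mulrA.
Qed.

Canonical ideal_equiv_rel := EquivRelPack ideal_equiv_equiv.

Definition Cl : Type := {eq_quot ideal_equiv_rel}.
HB.instance Definition _ := Choice.on Cl.
HB.instance Definition _ := EqQuotient.on Cl.

End IdealClasses.

Section ExteriorAlgebra.
Variables (K : fieldType) (N : nat).

(* x : ext_alg is the element sum_I x_I e_I of the exterior algebra of K^N,
   where e_I is the wedge of the e_i, i in I, in increasing order. *)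
Definition ext_alg : Type := {ffun {set 'I_N} -> K}.

Definition ext_one : ext_alg := [ffun I => (I == finset.set0)%:R].

(* Left multiplication by the vector v, determined by e_i /\ e_J = 0 if i is in
   J and e_i /\ e_J = (-1)^#{j in J | j < i} e_(J U {i}) otherwise. *)
Definition wedgel (v : 'rV[K]_N) (x : ext_alg) : ext_alg :=
  [ffun I : {set 'I_N} => \sum_(i in I)
    (-1) ^+ #|[set j in I | (j < i)%N]%SET| * v 0 i * x (I :\ i)%SET].

Definition wedge (s : seq 'rV[K]_N) : ext_alg := foldr wedgel ext_one s.

Lemma wedge_minor r (M : 'M[K]_(r, N)) (f : 'I_r -> 'I_N) :
  {homo f : i j / (i < j)%N} ->
  wedge [seq row i M | i <- enum 'I_r] [set f i | i : 'I_r]%SET =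
  \det (colsub f M).
Proof.
elim: r M f => [|r IHr] M f fincr.
  rewrite det_mx00 enum_ord0/= ffunE; case: eqP => // /eqP/negP; case.
  by apply/eqP/setP => i; rewrite finset.in_set0; apply/negbTE/imsetP => -[[]].
have fmono : {mono f : i j / (i < j)%N}.
  move=> i j; case: (ltngtP i j) => [/fincr ->//|/fincr ij|/val_inj ->].
    by apply/negbTE; rewrite -leqNgt ltnW.
  by rewrite ltnn.
have finj : injective f.
  move=> i j fij; case: (ltngtP i j) => [/fincr|/fincr|/val_inj//].
    by rewrite fij ltnn.
  by rewrite fij ltnn.
rewrite (expand_det_row _ ord0) enum_ordSl /= ffunE.
rewrite big_imset/=; last by move=> i j _ _ /finj.
apply: eq_big => [i|j _]; first by rewrite inE.
rewrite !mxE /cofactor add0n mulrCA mulrA; congr (_ * _ * _).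
  have hinj : injective (fun i => f (widen_ord (ltnW (ltn_ord j)) i)).
    by move=> i1 i2 /finj/(congr1 val)/= /val_inj.
  congr (_ ^+ _); rewrite -[RHS](card_ord j) -(card_imset _ hinj).
  apply: eq_card => l; rewrite inE; apply/andP/imsetP.
    move=> [/imsetP[i _ ->]]; rewrite fmono => ij.
    by exists (Ordinal ij) => //=; congr (f _); exact: val_inj.
  move=> [i _ ->] /=; rewrite imset_f//; split=> //.
  by rewrite fmono /=.
have -> : ([set f i | i : 'I_r.+1] :\ f j = [set f (lift j i) | i : 'I_r])%SET.
  apply/setP => l; rewrite !inE; apply/andP/imsetP.
    move=> [lj /imsetP[i _ lE]]; move: lj; rewrite lE (inj_eq finj) eq_sym.
    by case/unlift_some => i' -> _; exists i'.
  by move=> [i _ ->]; rewrite (inj_eq finj) eq_sym neq_lift imset_f.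
have -> : [seq row i M | i <- [seq lift ord0 i | i <- enum 'I_r]] =
          [seq row i (row' ord0 M) | i <- enum 'I_r].
  by rewrite -map_comp; apply: eq_map => i /=; apply/rowP => l; rewrite !mxE.
rewrite IHr => [|i1 i2 i12]; last by apply: fincr; rewrite /= /bump; lia.
by congr (\det _); apply/matrixP => i1 i2; rewrite !mxE.
Qed.

End ExteriorAlgebra.

Section Grassmannian.
Variables (K : fieldType) (r N : nat).

Definition grass : Type := {W : {vspace 'rV[K]_N} | \dim W == r}.
HB.instance Definition _ := Choice.on grass.

Definition frame : Type := set_type [set M : 'M[K]_(r, N) | row_free M].
HB.instance Definition _ := Choice.on frame.

Definition row_span (M : 'M[K]_(r, N)) : {vspace 'rV[K]_N} :=
  <<[tuple row i M | i < r]>>%VS.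

Lemma free_rowsE (M : 'M[K]_(r, N)) : free [tuple row i M | i < r] = row_free M.
Proof.
apply/freeP/idP => [h|fM c].
  apply: inj_row_free => v; rewrite mulmx_sum_row => vM; apply/rowP => i.
  rewrite mxE; apply: (h (fun i => v 0 i)); rewrite -[RHS]vM.
  by apply: eq_bigr => j _; rewrite nth_mktuple.
move=> c0 i; have : \row_i c i *m M = 0 *m M.
  rewrite mul0mx mulmx_sum_row -[RHS]c0.
  by apply: eq_bigr => j _; rewrite nth_mktuple mxE.
by move/(row_free_inj fM)/rowP/(_ i); rewrite !mxE.
Qed.

Lemma frame_free (M : frame) : row_free (val M).
Proof. by case: M => M /= /set_mem. Qed.

Lemma row_span_dim (M : frame) : \dim (row_span (val M)) == r.
Proof.
have := frame_free M; rewrite -free_rowsE /free /row_span => /eqP ->.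
by rewrite size_tuple.
Qed.

Definition span_of (M : frame) : grass :=
  exist (fun W => \dim W == r) _ (row_span_dim M).

Definition basis_mx (W : grass) : 'M[K]_(r, N) :=
  \matrix_(i < r) (vbasis (val W))`_i.

Lemma row_span_basis (W : grass) : row_span (basis_mx W) = val W.
Proof.
rewrite /row_span; have /eqP dW := valP W.
have -> : [tuple row i (basis_mx W) | i < r] = vbasis (val W) :> seq _.
  apply: (@eq_from_nth _ 0); rewrite !size_tuple ?dW// => i ir.
  by rewrite -[i]/(val (Ordinal ir)) nth_mktuple rowK.
exact: (span_basis (vbasisP _)).
Qed.

Lemma basis_mx_free (W : grass) : basis_mx W \in [set M | row_free M].
Proof.
apply/mem_set => /=; rewrite -free_rowsE /free -/(row_span _) row_span_basis.
by rewrite size_tuple; exact: (valP W).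
Qed.

Definition basis_frame (W : grass) : frame :=
  exist (fun M => M \in _) _ (basis_mx_free W).

Lemma basis_frameK : cancel basis_frame span_of.
Proof. by move=> W; apply: val_inj; exact: row_span_basis. Qed.

Lemma span_of_eq (M M' : frame) : span_of M = span_of M' ->
  exists2 g : 'M[K]_r, g \in unitmx & val M' = g *m val M.
Proof.
move=> /(congr1 val) /= MM'.
have sub : (val M' <= val M)%MS.
  apply/row_subP => i; have : row i (val M') \in row_span (val M).
    rewrite MM'; apply: memv_span; apply/tnthP; exists i.
    by rewrite tnth_mktuple.
  move=> /(@coord_span _ _ _ [tuple row i (val M) | i < r]) ->.
  apply: summx_sub => j _.
  by rewrite nth_mktuple; apply/scalemx_sub/row_sub.
have [g gE] := submxP sub; exists g => //.
rewrite -row_free_unit; have := frame_free M'; rewrite gE /row_free => /eqP rE.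
by rewrite eqn_leq rank_leq_row -[X in (X <= _)%N]rE mxrankM_maxl.
Qed.

Lemma span_of_mulmx (M M' : frame) (g : 'M[K]_r) :
  g \in unitmx -> val M' = g *m val M -> span_of M' = span_of M.
Proof.
have sub (A B : frame) (h : 'M[K]_r) : val A = h *m val B ->
    (row_span (val A) <= row_span (val B))%VS.
  move=> AE; apply/span_subvP => _ /tnthP[i ->]; rewrite tnth_mktuple AE.
  rewrite row_mul mulmx_sum_row; apply: memv_suml => j _; apply: memvZ.
  by apply: memv_span; apply/tnthP; exists j; rewrite tnth_mktuple.
move=> gu ME; apply/val_inj/eqP; rewrite eqEsubv; apply/andP; split.
  exact: sub ME.
by apply: (sub _ _ (invmx g)); rewrite ME mulKmx.
Qed.

Definition plucker_index : Type := {I : {set 'I_N} | #|I| == r}.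
HB.instance Definition _ := Finite.on plucker_index.

Definition plucker (M : 'M[K]_(r, N)) (I : plucker_index) : K :=
  wedge [seq row i M | i <- enum 'I_r] (val I).

Definition column_enum (I : plucker_index) (j : 'I_r) : 'I_N :=
  enum_val (cast_ord (esym (eqP (valP I))) j).

Lemma column_enum_homo I : {homo column_enum I : i j / (i < j)%N}.
Proof.
move=> i j ij; have i0 := column_enum I i.
have sI : sorted (relpre (@nat_of_ord N) ltn) (enum (val I)).
  rewrite /enum_mem; apply: sorted_filter => [a b c|]; first exact: ltn_trans.
  by rewrite -enumT -sorted_map val_enum_ord iota_ltn_sorted.
rewrite /column_enum !(enum_val_nth i0) /=.
apply: (sorted_ltn_nth _ i0 sI) => //; first by move=> a b c; exact: ltn_trans.
  by rewrite inE -cardE (eqP (valP I)).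
by rewrite inE -cardE (eqP (valP I)).
Qed.

Lemma column_enum_im I : [set column_enum I j | j : 'I_r]%SET = val I.
Proof.
apply/setP => l; apply/imsetP/idP => [[j _ ->]|lI]; first exact: enum_valP.
exists (cast_ord (eqP (valP I)) (enum_rank_in lI l)) => //.
by rewrite /column_enum cast_ordK enum_rankK_in.
Qed.

Lemma plucker_minor M I : plucker M I = \det (colsub (column_enum I) M).
Proof. by rewrite -(wedge_minor _ (@column_enum_homo I)) column_enum_im. Qed.

Lemma pluckerM (g : 'M[K]_r) (M : 'M[K]_(r, N)) I :
  plucker (g *m M) I = \det g * plucker M I.
Proof. by rewrite !plucker_minor -mulmx_colsub det_mulmx. Qed.

Lemma plucker_neq0 (M : frame) : exists I, plucker (val M) I != 0.
Proof.
have fM : row_full (val M)^T.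
  by rewrite /row_full mxrank_tr; exact: frame_free.
have [h hinj hu] : exists2 h : 'I_r -> 'I_N,
    injective h & colsub h (val M) \in unitmx.
  exists (fullrankfun fM); first exact: fullrankfun_inj.
  by rewrite -unitmx_tr -row_full_unit trmx_mxsub fullrowsub_full.
have hI : #|[set h j | j : 'I_r]%SET| == r.
  by rewrite card_imset// card_ord.
pose I : plucker_index := exist (fun I : {set 'I_N} => #|I| == r) _ hI.
exists I; rewrite plucker_minor.
have hE j : exists i, h j = column_enum I i.
  have : h j \in val I by apply: imset_f.
  by rewrite -column_enum_im => /imsetP[i _ ->]; exists i.
have [s sE] := choice hE.
have colE : colsub h (val M) = colsub s (colsub (column_enum I) (val M)).
  by apply/matrixP => i j; rewrite !mxE sE.
move: hu; rewrite colE -[X in colsub s X]mulmx1 -mulmx_colsub unitmx_mul.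
by case/andP; rewrite unitmxE unitfE.
Qed.

End Grassmannian.

Section BaseChange.
Variables (K L : fieldType) (f : {rmorphism K -> L}) (r N : nat).

Lemma map_frame_free (M : frame K r N) :
  map_mx f (val M) \in [set M | row_free M].
Proof. by apply/mem_set => /=; rewrite row_free_map; exact: frame_free. Qed.

Definition map_frame (M : frame K r N) : frame L r N :=
  exist (fun M => M \in _) _ (map_frame_free M).

(* L (x)_K W, as a subspace of L^N. *)
Definition grass_map (W : grass K r N) : grass L r N :=
  span_of (map_frame (basis_frame W)).

End BaseChange.

Lemma grass_map_span (K L : fieldType) (f : {rmorphism K -> L}) r N
    (M : frame K r N) : grass_map f (span_of M) = span_of (map_frame f M).
Proof.
have [g gu gE] := span_of_eq (basis_frameK (span_of M)).
have gu' : map_mx f g \in unitmx by rewrite map_unitmx.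
by apply/esym/(span_of_mulmx gu') => /=; rewrite -map_mxM -gE.
Qed.

Section Psi.
Variables (k : fieldExtType rat) (r N : nat).

Lemma plucker_fractional (M : frame k r N) :
  `[< is_fractional (ideal_gen (@plucker k r N (val M))) >].
Proof.
apply/asboolP; split; first by eexists; eexists.
have [I I0] := plucker_neq0 M; exists (plucker (val M) I) => //.
exists (fun J => (J == I)%:R) => [J|]; first exact: integral_nat.
rewrite (bigD1 I)//= eqxx mul1r big1 ?addr0// => J /negbTE ->.
by rewrite mul0r.
Qed.

Definition plucker_ideal (M : frame k r N) : frac_ideal k :=
  exist (fun A => `[< is_fractional A >]) _ (plucker_fractional M).

Definition Psi (W : grass k r N) : Cl k :=
  \pi_(Cl k) (plucker_ideal (basis_frame W)).

Lemma Psi_span (M : frame k r N) : Psi (span_of M) = \pi_(Cl k) (plucker_ideal M).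
Proof.
have [g gu gE] := span_of_eq (basis_frameK (span_of M)).
apply/eqmodP/asboolP; exists (\det g).
  by move: gu; rewrite unitmxE unitfE.
rewrite /= gE; apply/seteqP; split=> [x [c cO ->]|_ [x [c cO ->] <-]].
  exists (\sum_I c I * plucker (basis_mx (span_of M)) I); first by exists c.
  by rewrite mulr_sumr; apply: eq_bigr => I _; rewrite pluckerM mulrCA.
exists c => //; rewrite mulr_sumr; apply: eq_bigr => I _.
by rewrite pluckerM mulrCA.
Qed.

End Psi.

Section Places.
Variables (R : realType) (K : fieldType).

(* The trivial absolute value is excluded. *)
Record absval : Type := AbsVal {
  absval_fun :> K -> R;
  absval_ge0 : forall x, 0 <= absval_fun x;
  absval_eq0 : forall x, absval_fun x = 0 <-> x = 0;
  absvalM : forall x y, absval_fun (x * y) = absval_fun x * absval_fun y;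
  absval_triangle : forall x y,
    absval_fun (x + y) <= absval_fun x + absval_fun y;
  absval_nontrivial : exists2 x, x != 0 & absval_fun x != 1 }.
HB.instance Definition _ := gen_eqMixin absval.
HB.instance Definition _ := gen_choiceMixin absval.

Definition abs_space (a : absval) : Type := K.
HB.instance Definition _ (a : absval) := GRing.Field.on (abs_space a).
HB.instance Definition _ (a : absval) := isPointed.Build (abs_space a) 0.

Definition abs_dist (a : absval) (x y : abs_space a) : R := a ((x : K) - y).

Lemma absval1 (a : absval) : a 1 = 1.
Proof.
have a10 : a 1 != 0 by apply/eqP => /absval_eq0/eqP; rewrite oner_eq0.
by apply: (mulfI a10); rewrite mulr1 -absvalM mulr1.
Qed.

Lemma absvalN (a : absval) x : a (- x) = a x.
Proof.
suff aN1 : a (-1) = 1 by rewrite -mulN1r absvalM aN1 mul1r.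
apply/eqP; rewrite -(@eqrXn2 _ 2) ?absval_ge0// expr1n expr2 -absvalM.
by rewrite mulrNN mulr1 absval1.
Qed.

Lemma abs_distxx a x : @abs_dist a x x = 0.
Proof. by apply/absval_eq0; rewrite subrr. Qed.

Lemma abs_dist_eq0 a x y : @abs_dist a x y = 0 -> x = y.
Proof. by move=> /absval_eq0/eqP; rewrite subr_eq0 => /eqP. Qed.

Lemma abs_dist_sym a x y : @abs_dist a x y = @abs_dist a y x.
Proof. by rewrite /abs_dist -absvalN opprB. Qed.

Lemma abs_dist_triangle a y x z :
  @abs_dist a x z <= @abs_dist a x y + @abs_dist a y z.
Proof. by apply: le_trans (absval_triangle _ _ _); rewrite subrKA. Qed.

HB.instance Definition _ (a : absval) := @isMetric.Build R (abs_space a)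
  (@abs_dist a) (@abs_distxx a) (@abs_dist_eq0 a) (@abs_dist_sym a)
  (@abs_dist_triangle a).

Definition absval_equiv (a b : absval) : bool :=
  `[< forall A : set K, @open (abs_space a) A <-> @open (abs_space b) A >].

Lemma absval_equiv_equiv : equiv_class_of absval_equiv.
Proof.
split=> [a|a b|b a c].
- exact/asboolP.
- by apply/asboolP/asboolP => ab A; rewrite ab.
- by move=> /asboolP ab /asboolP bc; apply/asboolP => A; rewrite ab.
Qed.

Canonical absval_equiv_rel := EquivRelPack absval_equiv_equiv.

Definition place : Type := {eq_quot absval_equiv_rel}.
HB.instance Definition _ := Choice.on place.
HB.instance Definition _ := EqQuotient.on place.

End Places.

Section Completion.
Variables (R : realType) (k : fieldType).

(* A completion is determined by these properties up to a unique isomorphism of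
   topological fields over k, which depends only on the place of a. *)
Record completion (a : absval R k) : Type := Completion {
  cpl_field : fieldType;
  cpl_abs : absval R cpl_field;
  cpl_emb : {rmorphism k -> abs_space cpl_abs};
  cpl_embE : forall x, cpl_abs (cpl_emb x) = a x;
  cpl_dense : dense (range cpl_emb : set (abs_space cpl_abs));
  cpl_complete : forall F : set_system (abs_space cpl_abs),
    ProperFilter F -> cauchy F -> cvg F }.

Definition cpl_space (a : absval R k) (C : completion a) : fieldType :=
  abs_space (cpl_abs C).

End Completion.

Section GrassTopology.
Variables (R : realType) (K : fieldType) (a : absval R K) (r N : nat).

(* The v-adic topology: the quotient topology from the open subspace of
   r-by-N matrices of rank r, whose orbits under GL_r are the fibers of
   span_of. *)
Definition grass_open : set_system (grass (abs_space a) r N) :=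
  [set U | open (@span_of (abs_space a) r N @^-1` U)].

Lemma grass_openT : grass_open setT.
Proof. by rewrite /grass_open /= preimage_setT; exact: openT. Qed.

Lemma grass_openI : setI_closed grass_open.
Proof. by move=> U V oU oV; rewrite /grass_open /= preimage_setI; exact: openI. Qed.

Lemma grass_open_bigU (I : Type) (f : I -> set (grass (abs_space a) r N)) :
  (forall i, grass_open (f i)) -> grass_open (\bigcup_i f i).
Proof.
move=> fo; rewrite /grass_open /= preimage_bigcup.
by apply: bigcup_open => i _; exact: fo.
Qed.

HB.instance Definition _ := isOpenTopological.Build (grass (abs_space a) r N)
  grass_openT grass_openI grass_open_bigU.

End GrassTopology.

(* Main.v *)
Require Import Defs.
From mathcomp Require Import all_boot all_order all_algebra all_field finmap.
From mathcomp Require Import all_classical all_reals all_analysis.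
From mathcomp Require Import perm ring lra zify.

(** Write O for the ring of integers of k and A(M) for the ideal generated by
    the maximal minors of an r-by-N matrix M.

    Every subspace over k_v can be moved slightly so that it is the row space of
    a matrix (1 | T_v), so weak approximation for the entries gives one matrix
    M = (1 | T) over k whose row space lies in all the prescribed open sets, and
    it stays there under changes of M that are small at the places of S
    ([local_chart], [weak_approximation]). The class of A(M) is then corrected
    by adding a single small number x to the entry in row 1, column r + 1.

    Let d > 0 be an integer that makes d A(M) integral. If the denominator ideal
    {a in O | a x in O} is coprime to d, then the new matrix M' satisfies
    A(M') = A(M) (O + O x) ([plucker_ideal_perturb]): at the primes dividing d
    the number x is integral and M' arises from M by adding x times a column to
    another one, while at the other primes the minors of M are integral.
    So the class of A(M') is c as soon as O + O x lies in the class
    c A(M)^-1.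

    It remains to find a small x with O + O x in the class of a given ideal G
    and with denominators coprime to d ([invertible_two_generated],
    [small_ratio]). Choose y in G such that y G^-1 is coprime to d and put
    J = y^-1 G, an ideal with inverse J^-1 = y G^-1 contained in O; then choose
    z in J such that z J^-1 is coprime to J^-1, and a positive integer n in
    z J^-1. For all integers j > 0 and t >= 0, with m = 1 + d n t and
    x = d^j z / m, the ideals m J^-1 and d^j z J^-1 are coprime, that is
    m (O + O x) = J. If d is small at the nonarchimedean places of S, then a
    large j makes x small there, whatever t is, and after that a large t = 2^l
    makes x small at the archimedean places.

    The two facts on ideals used here are obtained without prime factorization.
    Invertibility of a finitely generated ideal reduces to two generators
    ([family_invertible]) and there to the integrality of the Horner tails of
    an integer polynomial with coprime coefficients ([unit_split]). The
    existence of the elements y and z ([invertible_coprime_element]) says that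
    G / h G is cyclic for an integer h > 0, which follows from the idempotents
    of O / h O ([power_idempotent], [idempotent_cyclic]). *)

Set Implicit Arguments.
Unset Strict Implicit.
Unset Printing Implicit Defensive.
Import Order.TTheory GRing.Theory Num.Theory.
Import numFieldNormedType.Exports.
Local Open Scope classical_set_scope.
Local Open Scope quotient_scope.
Local Open Scope ring_scope.

(** * Integrality and invertibility of finitely generated ideals *)

Section Integers.
Variable k : fieldExtType rat.
Local Notation O := (@ring_of_integers k).

Lemma ringint_nat n : O n%:R. Proof. exact: integral_nat. Qed.
Lemma ringint0 : O 0. Proof. exact: ringint_nat 0%N. Qed.
Lemma ringint1 : O 1. Proof. exact: ringint_nat 1%N. Qed.
Lemma ringintD x y : O x -> O y -> O (x + y). Proof. exact: integral_add. Qed.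
Lemma ringintM x y : O x -> O y -> O (x * y). Proof. exact: integral_mul. Qed.
Lemma ringintN x : O x -> O (- x). Proof. exact: integral_opp. Qed.
Lemma ringintB x y : O x -> O y -> O (x - y). Proof. exact: integral_sub. Qed.
Lemma ringintX x n : O x -> O (x ^+ n).
Proof. by move=> Ox; elim: n => [|n IH]; [exact: ringint1|rewrite exprS; exact: ringintM]. Qed.
Lemma ringint_int (z : int) : O z%:~R. Proof. exact: integral_id. Qed.
Lemma ringint_sum (I : Type) (s : seq I) (P : pred I) (F : I -> k) :
  (forall i, P i -> O (F i)) -> O (\sum_(i <- s | P i) F i).
Proof. by move=> FO; apply: big_ind => //; [exact: ringint0|exact: ringintD]. Qed.

Lemma intrk_inj : injective (intr : int -> k).
Proof.
move=> x y /eqP; rewrite -subr_eq0 -intrB => /eqP h.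
apply/eqP; rewrite -subr_eq0; apply: contraT => n0.
have := fmorph_eq0 (in_alg k) ((x - y)%:~R : rat).
by rewrite rmorph_int h eqxx intr_eq0 (negbTE n0).
Qed.

Lemma natk_neq0 n : (0 < n)%N -> n%:R != 0 :> k.
Proof.
move=> n0; rewrite -[n%:R]/(n%:Z%:~R) -[0]/(0%:~R).
by rewrite (inj_eq intrk_inj); lia.
Qed.

(** By Cayley and Hamilton: b is an eigenvalue of an integer matrix. *)
Lemma integral_stable n (v : 'rV[k]_n) (N : 'M[int]_n) (b : k) :
  v != 0 -> v *m map_mx intr N = b *: v -> O b.
Proof.
move=> v0 vN; exists (char_poly N); first exact: char_poly_monic.
rewrite map_char_poly -eigenvalue_root_char.
by apply/eigenvalueP; exists v.
Qed.

Local Notation pk p := (map_poly (intr : int -> k) p).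

Lemma horner_int_poly (p : {poly int}) n x : (size p <= n)%N ->
  (pk p).[x] = \sum_(l < n) (p`_l)%:~R * x ^+ l.
Proof.
move=> pn; rewrite (@horner_coef_wide _ n); last first.
  by apply: leq_trans pn; apply: size_poly.
by apply: eq_bigr => i _; rewrite coef_map.
Qed.

(** For p of degree n, let b_j be the value at x of the quotient of p by X^j. If
    p(x) = 0 then b_j maps the group spanned by 1, x, ..., x^(n-1) into itself:
    b_j x^i has degree less than n in x if i < j, and for i >= j the
    relation p(x) = 0 turns x^j b_j into minus the value of the terms of p of
    degree less than j. *)
Lemma horner_tail_integral (p : {poly int}) x j : (pk p).[x] = 0 ->
  O (pk (drop_poly j p)).[x].
Proof.
move=> px; set b := horner _ _.
case: (posnP (size p).-1) => [sp|n0].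
  have : (size p <= 1)%N by lia.
  move=> /size1_polyC pE; rewrite /b pE.
  case: j {b} => [|j].
    rewrite drop_poly0l map_polyC hornerC; exact: ringint_int.
  rewrite drop_poly_eq0 ?rmorph0 ?horner0; first exact: ringint0.
  by rewrite (leq_trans (size_polyC_leq1 _)).
set n := (size p).-1 in n0.
have sz : size p = n.+1 by rewrite /n; lia.
pose q i : {poly int} := if (i < j)%N then drop_poly j p * 'X^i
                         else - (take_poly j p * 'X^(i - j)).
have sq i : (i < n)%N -> (size (q i) <= n)%N.
  move=> iN; rewrite /q; case: ltnP => ij.
    by apply: leq_trans (size_polyMleq _ _) _; rewrite size_drop_poly size_polyXn sz; lia.
  rewrite size_polyN; apply: leq_trans (size_polyMleq _ _) _; rewrite size_polyXn.
  by move: (size_take_poly j p); move: (size _) => m; lia.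
have hq i : (pk (q i)).[x] = b * x ^+ i.
  rewrite /q; case: ltnP => ij.
    by rewrite rmorphM /= map_polyXn hornerM hornerXn.
  have := poly_take_drop j p => /(congr1 (fun p => (pk p).[x])).
  rewrite px rmorphD rmorphM /= map_polyXn hornerD hornerM hornerXn -/b => /eqP.
  rewrite addr_eq0 => /eqP h.
  rewrite rmorphN rmorphM /= map_polyXn hornerN hornerM hornerXn h.
  by rewrite -{2}(subnK ij) exprD; ring.
pose v : 'rV[k]_n := \row_l x ^+ l.
pose N : 'M[int]_n := \matrix_(l, i) (q i)`_l.
apply: (@integral_stable n v N).
  apply/eqP => /rowP /(_ (Ordinal n0)); rewrite !mxE expr0 => /eqP.
  by rewrite oner_eq0.
apply/rowP => i; rewrite !mxE -hq (horner_int_poly x (sq i (ltn_ord i))).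
by apply: eq_bigr => l _; rewrite !mxE mulrC.
Qed.

Lemma bezout_coefs (n : nat) (c : nat -> int) :
  exists e : nat -> int,
    \sum_(i < n) e i * c i = (\big[gcdn/0%N]_(i < n) `|c i|%N)%:Z.
Proof.
elim: n => [|n [e eE]]; first by exists (fun=> 0); rewrite !big_ord0.
rewrite big_ord_recr /=.
set g := \big[_/_]_(i < n) _ in eE *.
have [u [v uvE]] := Bezoutz g%:Z (c n).
exists (fun i => if (i < n)%N then u * e i else v).
rewrite big_ord_recr /= ltnn.
rewrite (eq_bigr (fun i : 'I_n => u * (e i * c i))); last first.
  by move=> i _; rewrite ltn_ord mulrA.
by rewrite -mulr_sumr eE uvE /gcdz /=.
Qed.


(** The degree bound, uniform in x, is what makes absolute values that are trivial
    on the integers bounded on all of k, hence trivial. *)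
Lemma int_poly_root (x : k) : exists p : {poly int},
  [/\ p != 0, (pk p).[x] = 0 & (size p <= (\dim {:k}).+1)%N].
Proof.
have /polyOver1P [q qE] := minPolyOver 1 x.
have [p [a a0 pE]] := rat_poly_scale q.
have q0 : q != 0.
  apply/eqP => q0; have := monic_minPoly 1 x; rewrite qE q0 rmorph0.
  by rewrite monicE lead_coef0 eq_sym oner_eq0.
have pE' : map_poly intr p = a%:~R *: q.
  by rewrite pE scalerA mulfV ?scale1r ?intr_eq0.
have algz (z : int) : in_alg k z%:~R = z%:~R by rewrite rmorph_int.
have pkE : pk p = a%:~R *: minPoly 1 x.
  rewrite qE -[RHS](_ : map_poly (in_alg k) (a%:~R *: q) = _).
    by rewrite -pE' -map_poly_comp; apply: eq_map_poly => z; exact/esym/algz.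
  apply/polyP => i; rewrite coef_map !coefZ coef_map -algz; exact: rmorphM.
exists p; split.
- apply: contraNneq q0 => p0; move: pE'; rewrite p0 rmorph0 => /esym/eqP.
  by rewrite scaler_eq0 intr_eq0 (negbTE a0).
- by rewrite pkE hornerZ minPolyxx mulr0.
have <- : size (map_poly (intr : int -> rat) p) = size p.
  by apply: size_map_inj_poly => //; exact: intr_inj.
rewrite pE' size_scale ?intr_eq0 // -(size_map_poly (in_alg k)) -qE size_minPoly ltnS.

have <- : \dim <<1; x>>%VS = adjoin_degree 1 x by rewrite dim_Fadjoin dimv1 muln1.
exact/dimvS/subvf.
Qed.

Lemma horner_drop_polyS (p : {poly int}) j x :
  (pk (drop_poly j p)).[x] = (p`_j)%:~R + x * (pk (drop_poly j.+1 p)).[x].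
Proof.
have -> : drop_poly j p = (p`_j)%:P + drop_poly j.+1 p * 'X.
  apply/polyP => i; rewrite coef_drop_poly coefD coefC coefMX coef_drop_poly.
  by case: i => [|i] /=; rewrite ?addr0 ?add0r ?add0n// addnS addSn.
by rewrite rmorphD rmorphM /= map_polyC map_polyX hornerD hornerM hornerC hornerX mulrC.
Qed.

Lemma denominator (x : k) : exists2 d : nat, (0 < d)%N & O (d%:R * x).
Proof.
have [p [p0 px _]] := int_poly_root x.
have sz : (0 < size p)%N by rewrite size_poly_gt0.
have lc : lead_coef p != 0 by rewrite lead_coef_eq0.
have O_lc : O ((lead_coef p)%:~R * x).
  move: lc; rewrite lead_coefE; case E : (size p).-1 => [|n] lc.
    move: px; have /size1_polyC -> : (size p <= 1)%N by lia.
    by rewrite map_polyC hornerC coefC /= => ->; rewrite mul0r; exact: ringint0.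
  have sE : size p = n.+2 by lia.
  have := horner_tail_integral n px; rewrite 2!horner_drop_polyS.
  rewrite [drop_poly n.+2 p]drop_poly_eq0 ?sE// rmorph0 horner0 mulr0 addr0.
  move=> h; have := ringintB h (ringint_int p`_n); rewrite addrC addKr.
  by rewrite mulrC.
exists `|lead_coef p|%N; first by rewrite absz_gt0.
case/intP: (lead_coef p) O_lc => [|n|n] //=.
by rewrite rmorphN mulNr => /ringintN; rewrite opprK.
Qed.

Lemma divides_nat (o : k) : O o -> o != 0 ->
  exists2 n : nat, (0 < n)%N & exists2 o', O o' & o * o' = n%:R.
Proof.
move=> Oo o0; have [d d0 Od] := denominator o^-1.
by exists d => //; exists (d%:R * o^-1) => //; rewrite mulrCA mulfV ?mulr1.
Qed.

(** An explicit inverse of the ideal (1, x). Let c_0, ..., c_n be coprime integers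
    with c_0 + ... + c_n x^n = 0 and let b_j be the Horner tails, so that
    c_j = b_j - x b_(j+1) and all the b_j and x b_j are integral. A Bezout
    relation between the c_j becomes the relation P - x Q = 1. *)
Lemma unit_split (x : k) :
  exists P Q, [/\ O P, O Q, O (x * P) & P - x * Q = 1].
Proof.
have [p0 [p00 p0x _]] := int_poly_root x.
pose p := zprimitive p0.
have px : (pk p).[x] = 0.
  move: p0x; rewrite [p0]zpolyEprim -/p => /eqP.
  have -> : pk (zcontents p0 *: p) = (zcontents p0)%:~R *: pk p.
    by apply/polyP => i; rewrite coefZ !coef_map coefZ /= rmorphM.
  rewrite hornerZ mulf_eq0 => /orP[|/eqP//].
  rewrite -[0]/(0%:~R) (inj_eq intrk_inj) zcontents_eq0 (negbTE p00) //.
have [e eE] := bezout_coefs (size p) (fun i => p`_i).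
have e1 : \sum_(i < size p) e i * p`_i = 1.
  have := zcontents_primitive p0; rewrite p00 -/p /zcontents => c1; rewrite eE.
  move: c1; set g := \big[_/_]_(i < _) _ => c1.
  have : (g%:Z %| 1)%Z by rewrite -[X in (_ %| X)%Z]c1 dvdz_mull.
  by rewrite dvdz1 => /eqP /= ->.
pose B j := (pk (drop_poly j p)).[x].
have OBj j : O (B j) by exact: horner_tail_integral.
have BS j : B j = (p`_j)%:~R + x * B j.+1 by exact: horner_drop_polyS.
have OxB j : O (x * B j).
  case: j => [|j]; first by rewrite /B drop_poly0l px mulr0; exact: ringint0.
  by have := ringintB (OBj j) (ringint_int p`_j); rewrite BS addrC addKr.
exists (\sum_(i < size p) (e i)%:~R * B i), (\sum_(i < size p) (e i)%:~R * B i.+1).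
split.
- by apply: ringint_sum => i _; apply: ringintM => //; exact: ringint_int.
- by apply: ringint_sum => i _; apply: ringintM => //; exact: ringint_int.
- by rewrite mulr_sumr; apply: ringint_sum => i _; rewrite mulrCA; apply: ringintM => //; exact: ringint_int.
rewrite mulr_sumr -sumrB -[RHS]/(1%:~R) -e1 rmorph_sum /=; apply: eq_bigr => i _.
by rewrite BS rmorphM /=; ring.
Qed.

(** Invertibility of the ideal (a_0, ..., a_n), with inverse (u_0, ..., u_n).
    In the induction, each of the old generators a_i is compared with the new
    one b: [unit_split] gives 1 = f_i + (1 - f_i) with f_i b in O a_i and
    (1 - f_i) a_i in O b, which splits the term a_i u_i of the old relation
    into a part f_i a_i u_i kept by a_i and a part handed over to b. *)
Lemma family_invertible n (a : nat -> k) : a 0%N != 0 ->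
  exists u : nat -> k, (forall i j, (i <= n)%N -> (j <= n)%N -> O (a i * u j)) /\
    \sum_(i < n.+1) a i * u i = 1.
Proof.
move=> a0; elim: n => [|n [u [Ou u1]]].
  exists (fun=> (a 0%N)^-1); split; last by rewrite big_ord1 divff.
  by case=> // -[] // _ _; rewrite divff//; exact: ringint1.
pose b := a n.+1.
have H i : exists f g h, [/\ O f, O g, O h, f * b = h * a i & (1 - f) * a i = g * b].
  have [b0|b0] := eqVneq b 0.
    exists 1, 0, 0; split; rewrite ?b0; try ring; try exact: ringint0; exact: ringint1.
  have [P [Q [OP OQ OxP PQ]]] := unit_split (a i / b).
  exists (1 - P), (a i / b * P), (- Q); split => //.
  - exact: ringintB ringint1 OP.
  - exact: ringintN.
  - by rewrite -PQ; field.
  - by rewrite subKr; field.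
have [f /choice[g /choice[h fgh]]] := choice H.
exists (fun i => if (i <= n)%N then u i * f i
                 else \sum_(l < n.+1) u l * g l).
split=> [i j ilt jlt|].
  have Of l : O (f l) by have [] := fgh l.
  have Og l : O (g l) by have [] := fgh l.
  have Oh l : O (h l) by have [] := fgh l.
  case: leqP => jn.
    move: ilt; rewrite leq_eqVlt => /predU1P[->|iN].
      have [_ _ _ e _] := fgh j; have -> : a n.+1 * (u j * f j) = (a j * u j) * h j.
        by rewrite -/b [u j * _]mulrC mulrA [b * _]mulrC e; ring.
      by apply: ringintM => //; apply: Ou.
    by rewrite mulrA; apply: ringintM => //; apply: Ou.
  rewrite mulr_sumr; apply: ringint_sum => l _; rewrite mulrA.
  move: ilt; rewrite leq_eqVlt => /predU1P[->|iN]; last first.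
    by apply: ringintM => //; apply: Ou => //; rewrite -ltnS.
  have [_ _ _ _ e] := fgh l.
  have -> : a n.+1 * u l * g l = a l * u l * (1 - f l).
    by rewrite -/b mulrAC [b * _]mulrC -e; ring.
  by apply: ringintM; [apply: Ou; rewrite -ltnS|apply: ringintB => //; exact: ringint1].
rewrite big_ord_recr /= ltnn -[RHS]u1 mulr_sumr -big_split /=.
apply: eq_bigr => l _; rewrite -ltnS ltn_ord.
have [_ _ _ _ e] := fgh l.
have -> : a n.+1 * (u l * g l) = u l * (g l * b) by rewrite /b; ring.
rewrite -e; ring.
Qed.

(** The ring generated by s has a finite image modulo h, so the powers of s are
    eventually periodic modulo h, and a multiple of the period that is past the
    preperiod gives an idempotent power. *)
Lemma power_idempotent (s : k) (h : nat) : O s -> (0 < h)%N ->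
  exists2 n : nat, (0 < n)%N & exists2 o, O o & s ^+ (n + n) - s ^+ n = h%:R * o.
Proof.
case=> p pm ps h0.
pose m := (size p).-1.
have p0 : p != 0 by exact: monic_neq0.
have sp : size p = m.+1 by rewrite prednK ?size_poly_gt0.
pose r i : {poly int} := ('X^i %% p).
have sr i : s ^+ i = \sum_(l < m) ((r i)`_l)%:~R * s ^+ l.
  rewrite -horner_int_poly; last by rewrite -ltnS -sp ltn_modp.
  have /(congr1 (fun q => (pk q).[s])) := Pdiv.IdomainMonic.divp_eq pm 'X^i.
  rewrite map_polyXn hornerXn rmorphD rmorphM /= hornerD hornerM => ->.
  by rewrite (rootP ps) mulr0 add0r.
have lth (z : int) : (`|(z %% h)%Z|%N < h)%N.
  have h0' : h%:Z != 0 by lia.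
  have := ltz_mod z h0'; have := modz_ge0 z h0'; lia.
pose F (i : 'I_(#|{: {ffun 'I_m -> 'I_h}}|.+1)) : {ffun 'I_m -> 'I_h} :=
  [ffun l : 'I_m => Ordinal (lth (r i)`_l)].
(* F i records the remainder of X^i by p, reduced modulo h. *)
have [i [j [ij Fij]]] : exists i, exists j, i != j /\ F i = F j.
  have /injectivePn[i [j ij Fij]] : ~~ injectiveb F.
    by apply/negP => /injectiveP /leq_card; rewrite card_ord ltnn.
  by exists i, j.
wlog lt_ij : i j ij Fij / (i < j)%N => [hw|].
  have [lt_ij|lt_ji|/val_inj e] := ltngtP i j; last by rewrite e eqxx in ij.
    exact: (hw i j).
  by apply: (hw j i) => //; rewrite eq_sym.
have [c Oc cE] : exists2 o, O o & s ^+ j - s ^+ i = h%:R * o.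
  exists (\sum_(l < m) ((((r j)`_l - (r i)`_l) %/ h)%Z)%:~R * s ^+ l).
    by apply: ringint_sum => l _; apply: ringintM; [exact: ringint_int|apply: ringintX; exists p].
  rewrite 2!sr -sumrB mulr_sumr; apply: eq_bigr => l _.
  rewrite -mulrBl mulrA; congr (_ * _); rewrite -intrB.
  have -> : h%:R = h%:Z%:~R :> k by [].
  rewrite -intrM mulrC divzK//.
  move: Fij => /ffunP /(_ l); rewrite !ffunE => -[].
  have h0' : h%:Z != 0 by lia.
  move=> e; rewrite -eqz_mod_dvd; apply/eqP.
  have := modz_ge0 (r j)`_l h0'; have := modz_ge0 (r i)`_l h0'; lia.
have Os : O s by exists p.
pose t := (j - i)%N.
have t0 : (0 < t)%N by rewrite subn_gt0.
have step a b : exists2 o, O o & s ^+ (i + a + b * t) - s ^+ (i + a) = h%:R * o.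
  elim: b => [|b [z Oz zE]].
    by exists 0; [exact: ringint0|rewrite mul0n addn0 subrr mulr0].
  exists (z + c * s ^+ (a + b * t)).
    by apply: ringintD => //; apply: ringintM => //; exact: ringintX.
  rewrite mulrDr -zE mulrA -cE -{1}(subnKC (ltnW lt_ij)) -/t.
  by rewrite mulSn !exprD; ring.
pose n := (i.+1 * t)%N.
have ni : (i <= n)%N by rewrite /n; nia.
exists n; first by rewrite /n muln_gt0.
by have := step (n - i)%N i.+1; rewrite subnKC.
Qed.
End Integers.

(** * Generators of an ideal modulo an integer *)

Section Ideals.
Variable k : fieldExtType rat.
Local Notation O := (@ring_of_integers k).

Definition submod (P : set k) : Prop :=
  [/\ P 0, forall x y, P x -> P y -> P (x + y) &
      forall a x, O a -> P x -> P (a * x)].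

(** The quotient (O : G), which is the inverse of G when G is invertible. *)
Definition colon (G : set k) : set k := [set u | forall g, G g -> O (g * u)].

(** The relation 1 in G (O : G); it makes G finitely generated. *)
Definition invertible (G : set k) : Prop :=
  submod G /\ exists s : seq (k * k),
    (forall p, p \in s -> G p.1 /\ colon G p.2) /\ \sum_(p <- s) p.1 * p.2 = 1.

Lemma submodN (P : set k) x : submod P -> P x -> P (- x).
Proof.
by case=> _ _ PM Px; rewrite -mulN1r; apply: PM => //; apply: ringintN; exact: ringint1.
Qed.

Lemma submodB (P : set k) x y : submod P -> P x -> P y -> P (x - y).
Proof. by move=> sP Px Py; case: (sP) => _ PD _; apply: PD => //; exact: submodN. Qed.

Lemma submod_sum (P : set k) (I : eqType) (s : seq I) (F : I -> k) :
  submod P -> (forall i, i \in s -> P (F i)) -> P (\sum_(i <- s) F i).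
Proof.
move=> [P0 PD _] FP; rewrite big_seq_cond.
by apply: big_ind => // i; rewrite andbT => /FP.
Qed.

Lemma submod_colon (G : set k) : submod (colon G).
Proof.
split=> [g _|x y Gx Gy g Gg|a x Oa Gx g Gg]; first by rewrite mulr0; exact: ringint0.
  by rewrite mulrDr; apply: ringintD; [exact: Gx|exact: Gy].
by rewrite mulrCA; apply: ringintM => //; exact: Gx.
Qed.

Lemma submod_multiples (h : nat) : submod [set h%:R * a | a in O].
Proof.
split=> [|_ _ [x Ox <-] [y Oy <-]|a _ Oa [x Ox <-]].
- by exists 0; [exact: ringint0|rewrite mulr0].
- by exists (x + y); [exact: ringintD|rewrite mulrDr].
- by exists (a * x); [exact: ringintM|rewrite mulrCA].
Qed.

(** Let e be idempotent modulo h and in the ideal G (O : G) + h O. The first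
    term b of a sum of products representing e has a power f that is idempotent
    modulo h; on the component f the factor a of b = a u already generates, and
    on the complementary component b is nilpotent, so that e (1 - f) is a
    multiple of the sum of the other terms and the induction supplies a
    generator y. Then f a + (1 - f) y works on both components. *)
Lemma idempotent_cyclic (G : set k) (h : nat) (s : seq (k * k)) (e : k) :
  submod G -> (0 < h)%N ->
  let H := [set h%:R * a | a in O] in
  (forall p, p \in s -> G p.1 /\ colon G p.2) -> O e -> H (e ^+ 2 - e) ->
  H (e - \sum_(p <- s) p.1 * p.2) ->
  exists y i, [/\ G y, colon G i & H (e - y * i)].
Proof.
move=> sG h0 H; have [G0 GD GM] := sG; have [C0 CD CM] := submod_colon G.
have sH : submod H := submod_multiples h.
have [_ HD HM] := sH.
move sz : (size s) => l; elim: l s sz e => [|l IH] [|[a u] s] //= sz e sP Oe He eE.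
  by exists 0, 0; split => //; rewrite mul0r; rewrite big_nil in eE.
have /= [Ga Cu] := sP (a, u) (mem_head _ _).
move: eE; rewrite big_cons /=; set t := \sum_(p <- s) _ => eE.
have tail_P p : p \in s -> G p.1 /\ colon G p.2.
  by move=> ps; apply: sP; rewrite in_cons ps orbT.
have Ot : O t.
  rewrite /t big_seq_cond; apply: ringint_sum => p; rewrite andbT => /tail_P[Gp Cp].
  exact: Cp.
pose b := a * u; have Ob : O b by exact: Cu.
have [n n0 [c Oc cE]] := power_idempotent Ob h0.
pose f := b ^+ n; have Of : O f by exact: ringintX.
have Hf : H (f ^+ 2 - f) by exists c => //; rewrite -cE /f exprD expr2.
(* 1 - b divides 1 - b^n = 1 - f, with quotient F. *)
pose F := \sum_(i < n) b ^+ i.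
have OF : O F by apply: ringint_sum => i _; exact: ringintX.
have FE : (1 - b) * F = 1 - f by rewrite -[RHS]opprB /f subrX1 -/F; ring.
pose s' := [seq (p.1, e * F * p.2) | p <- s].
have s'P p : p \in s' -> G p.1 /\ colon G p.2.
  move=> /mapP[q qs ->] /=; have [Gq Cq] := tail_P q qs; split => //.
  by apply: CM => //; exact: ringintM.
have s'E : \sum_(p <- s') p.1 * p.2 = e * F * t.
  by rewrite big_map [RHS]mulr_sumr; apply: eq_bigr => p _ /=; ring.
have O1f : O (1 - f) by apply: ringintB => //; exact: ringint1.
have ss' : size s' = l by rewrite size_map; case: sz.
have [||y [i [Gy Ci Hyi]]] := IH s' ss' (e * (1 - f)) s'P (ringintM Oe O1f).
- have -> : (e * (1 - f)) ^+ 2 - e * (1 - f) =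
            (1 - f) ^+ 2 * (e ^+ 2 - e) + e * (f ^+ 2 - f) by ring.
  by apply: HD; apply: HM => //; exact: ringintX.
- rewrite s'E -FE.
  have -> : e * ((1 - b) * F) - e * F * t =
            F * e * (e - (b + t)) + - F * (e ^+ 2 - e) by ring.
  by apply: HD; apply: HM => //; [exact: ringintM|exact: ringintN].
pose u' := u * b ^+ n.-1.
have Cu' : colon G u' by rewrite /u' mulrC; apply: CM => //; exact: ringintX.
have fE : a * u' = f by rewrite /f /u' -(prednK n0) exprS /b; ring.
exists (f * a + (1 - f) * y), (e * f * u' + (1 - f) * i); split.
- by apply: GD; apply: GM.
- by apply: CD; apply: CM => //; exact: ringintM.
have -> : e - (f * a + (1 - f) * y) * (e * f * u' + (1 - f) * i) =
    (a * i + e * (y * u') - 3%:R * e) * (f ^+ 2 - f) +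
    (1 - f) ^+ 2 * (e * (1 - f) - y * i).
  have -> : (f * a + (1 - f) * y) * (e * f * u' + (1 - f) * i) =
    e * f ^+ 2 * (a * u') + f * (1 - f) * (a * i + e * (y * u')) +
    (1 - f) ^+ 2 * (y * i) by ring.
  by rewrite fE; ring.
apply: HD; apply: HM => //; last exact: ringintX.
apply: ringintB; last by apply: ringintM => //; exact: ringint_nat.
by apply: ringintD; [exact: Ci|apply: ringintM => //; exact: Cu'].
Qed.

Lemma invertible_neq0 (G : set k) : invertible G ->
  exists g i, [/\ G g, colon G i, g != 0 & i != 0].
Proof.
move=> [sG [s [sP s1]]].
have [/allP s0|/allPn[p ps]] := boolP (all (fun p => p.1 * p.2 == 0) s).
  move: s1; rewrite big_seq_cond big1 => [/eqP|p]; first by rewrite eq_sym oner_eq0.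
  by rewrite andbT => /s0/eqP.
by rewrite mulf_eq0 negb_or => /andP[p1 p2]; have [Gp Cp] := sP p ps; exists p.1, p.2.
Qed.

(** The generators of G modulo h G are the elements y for which the integral ideal
    y (O : G) is coprime to h. If y = 0 comes out then h is a unit, and every
    element of G is a generator. *)
Lemma invertible_coprime_element (G : set k) (h : nat) : invertible G -> (0 < h)%N ->
  exists y i c, [/\ G y, y != 0, colon G i, O c & y * i + h%:R * c = 1].
Proof.
move=> iG h0; have [sG [s [sP s1]]] := iG.
have [||y [i [Gy Ci]]] := idempotent_cyclic sG h0 sP (ringint1 k).
- by exists 0; [exact: ringint0|rewrite /= expr1n subrr mulr0].
- by exists 0; [exact: ringint0|rewrite /= s1 subrr mulr0].
move=> [c Oc cE]; have [y0|y0] := eqVneq y 0; last first.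
  by exists y, i, c; rewrite cE; split => //; ring.
have [g [_ [Gg _ g0 _]]] := invertible_neq0 iG.
exists g, 0, c; split => //; first by case: (submod_colon G).
by rewrite cE y0; ring.
Qed.

(** With J = y^-1 G and J^-1 = (O : J), which is contained in O, the point is the
    relation 1 in m J^-1 + d^j z J^-1. It is a product of comaximalities:
    J^-1 is coprime to d by the choice of y and to z J^-1 by the choice of z,
    while m = 1 + d n t is coprime to d and to n, which lies in z J^-1.
    Multiplying by an element of J turns the relation into
    J = m O + d^j z O. The second conclusion holds because the denominator ideal
    of x contains m J^-1. *)
Lemma invertible_two_generated (G : set k) (d : nat) : invertible G -> (0 < d)%N ->
  exists y z n, [/\ y != 0, z != 0, (0 < n)%N &
  forall j s : nat, (0 < j)%N ->
    let m : k := (1 + d * n * s)%:R in let x := d%:R ^+ j * z / m in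
    (forall w, G (y * m * w) <-> exists a b, [/\ O a, O b & w = a + b * x]) /\
    exists a b, [/\ O a, O b, O (a * x) & a + d%:R * b = 1]].
Proof.
move=> iG d0.
have [y [i0 [c0 [Gy y0 Ci0 Oc0 e0]]]] := invertible_coprime_element iG d0.
have [sG [s [sP s1]]] := iG; have [G0 GD GM] := sG.
pose J : set k := [set w | G (y * w)].
have sJ : submod J.
  split=> [|u v Ju Jv|a u Oa Ju]; rewrite /J /=.
  - by rewrite mulr0.
  - by rewrite mulrDr; exact: GD.
  - by rewrite mulrCA; exact: GM.
have CJ u : colon G u -> colon J (y * u).
  by move=> Cu w Jw; rewrite mulrCA mulrA; exact: Cu.
have iJ : invertible J.
  split => //; exists [seq (p.1 / y, y * p.2) | p <- s]; split.
    move=> p /mapP[q qs ->] /=; have [Gq Cq] := sP q qs; split; last exact: CJ.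
    by rewrite /J /= mulrCA mulfV ?mulr1.
  by rewrite big_map -[RHS]s1; apply: eq_bigr => p _ /=; field.
have J1 : J 1 by rewrite /J /= mulr1.
have [CJ0 CJD CJM] := submod_colon J.
have OJ u : colon J u -> O u by move=> /(_ 1 J1); rewrite mul1r.
have [_ [u0 [_ Cu0 _ u0_neq0]]] := invertible_neq0 iJ.
have [n0 n0_gt0 [v0 Ov0 n0E]] := divides_nat (OJ _ Cu0) u0_neq0.
have Cn0 : colon J n0%:R by rewrite -n0E mulrC; exact: CJM.
have [z [i1 [c1 [Jz z0 Ci1 Oc1 e1]]]] := invertible_coprime_element iJ n0_gt0.
have zn0 : z * n0%:R != 0 by rewrite mulf_neq0// natk_neq0.
have [n n_gt0 [v1 Ov1 nE]] := divides_nat (Cn0 _ Jz) zn0.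
exists y, z, n; split => // j t j0 m x.
have m0 : m != 0 by exact: natk_neq0.
have Om : O m by exact: ringint_nat.
have mE : m = (1 + d * n * t)%:R by [].
have xE : x = d%:R ^+ j * z / m by [].
clearbody x; clearbody m.
have Od : O d%:R by exact: ringint_nat.
have Odj : O (d%:R ^+ j) by exact: ringintX.
have Ci0' := CJ _ Ci0; set a0 := y * i0 in Ci0' e0.
have Oa0 := OJ _ Ci0'.
split; last first.
  exists (m * a0), (c0 - n%:R * t%:R * a0); split.
  - exact: ringintM.
  - by apply: ringintB => //; apply: ringintM => //; apply: ringintM; exact: ringint_nat.
  - have -> : m * a0 * x = d%:R ^+ j * (z * a0) by rewrite xE; field.
    by apply: ringintM => //; exact: Ci0'.
  by rewrite -[RHS]e0 mE natrD !natrM; ring.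
(* p + d^j q = 1 : the ideal J^-1 is coprime to d^j *)
have [p [q [Cp Oq e2]]] : exists p q, [/\ colon J p, O q & p + d%:R ^+ j * q = 1].
  elim: j {j0 x xE Odj} => [|j [p [q [Cp Oq e]]]].
    exists 0, 1; split; [exact: CJ0|exact: ringint1|by rewrite expr0; ring].
  exists (p + a0 * (d%:R ^+ j * q)), (q * c0); split.
  - by apply: CJD => //; rewrite mulrC; apply: CJM => //; apply: ringintM => //; exact: ringintX.
  - exact: ringintM.
  have -> : p + a0 * (d%:R ^+ j * q) + d%:R ^+ j.+1 * (q * c0) =
    p + d%:R ^+ j * q * (a0 + d%:R * c0) by rewrite exprS; ring.
  by rewrite e0 mulr1.
(* m is coprime to d^j z J^-1, since d n t = m - 1 with n in z J^-1 *)
have [q' [i2 [Oq' Ci2 e3]]] : exists q' i2,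
    [/\ O q', colon J i2 & m * q' + d%:R ^+ j * z * i2 = 1].
  exists (\sum_(i < j) (1 - m) ^+ i), (v1 * n%:R ^+ j.-1 * (- t%:R) ^+ j * n0%:R).
  have O1m : O (1 - m) by apply: ringintB => //; exact: ringint1.
  have Ont : O (v1 * n%:R ^+ j.-1 * (- t%:R) ^+ j).
    apply: ringintM; last by apply: ringintX; apply: ringintN; exact: ringint_nat.
    by apply: ringintM => //; apply: ringintX; exact: ringint_nat.
  split; [by apply: ringint_sum => i _; exact: ringintX|exact: CJM|].
  have h : m * (\sum_(i < j) (1 - m) ^+ i) = 1 - (1 - m) ^+ j.
    by rewrite -[RHS]opprB subrX1; ring.
  rewrite h.
  have -> : d%:R ^+ j * z * (v1 * n%:R ^+ j.-1 * (- t%:R) ^+ j * n0%:R) =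
      d%:R ^+ j * (n%:R * n%:R ^+ j.-1) * (- t%:R) ^+ j by rewrite -nE; ring.
  rewrite -exprS prednK// -!exprMn.
  have -> : d%:R * n%:R * - t%:R = 1 - m :> k by rewrite mE natrD !natrM; ring.
  by rewrite subrK.
pose A := p + d%:R ^+ j * q * c1 * n0%:R; pose B := q * i1.
have CA : colon J A by apply: CJD => //; apply: CJM => //; apply: ringintM => //; exact: ringintM.
have CB : colon J B by exact: CJM.
have e4 : A + d%:R ^+ j * z * B = 1.
  have -> : A + d%:R ^+ j * z * B = p + d%:R ^+ j * q * (z * i1 + n0%:R * c1).
    by rewrite /A /B; ring.
  by rewrite e1 mulr1.
have CA' : colon J (q' * A) by exact: CJM.
have CB' : colon J (m * q' * B + i2) by apply: CJD => //; apply: CJM => //; exact: ringintM.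
have e5 : m * (q' * A) + d%:R ^+ j * z * (m * q' * B + i2) = 1.
  have -> : m * (q' * A) + d%:R ^+ j * z * (m * q' * B + i2) =
    m * q' * (A + d%:R ^+ j * z * B) + d%:R ^+ j * z * i2 by ring.
  by rewrite e4 mulr1.
move=> w; split.
  rewrite -mulrA => Jmw; exists (m * w * (q' * A)), (m * w * (m * q' * B + i2)).
  split; [exact: CA'|exact: CB'|].
  by rewrite -[LHS]mulr1 -e5 xE; field.
move=> [a [b [Oa Ob ->]]].
have -> : y * m * (a + b * x) = m * a * (y * 1) + (b * d%:R ^+ j) * (y * z).
  by rewrite xE; field.
by apply: GD; apply: GM => //; exact: ringintM.
Qed.
End Ideals.

(** * Absolute values and weak approximation *)

Section AbsVal.
Variables (R : realType) (K : fieldType).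
Implicit Types a b c : absval R K.

Lemma absval0 a : a 0 = 0. Proof. exact/absval_eq0. Qed.

Lemma absval_gt0 a x : x != 0 -> 0 < a x.
Proof.
move=> x0; rewrite lt_neqAle absval_ge0 andbT eq_sym.
by apply: contra_neq x0 => /absval_eq0.
Qed.

Lemma absvalX a x n : a (x ^+ n) = a x ^+ n.
Proof. by elim: n => [|n IH]; rewrite ?absval1// !exprS absvalM IH. Qed.

Lemma absvalV a x : a x^-1 = (a x)^-1.
Proof.
have [->|x0] := eqVneq x 0; first by rewrite !(invr0, absval0).
have ax0 : a x != 0 by rewrite gt_eqF ?absval_gt0.
by apply: (mulfI ax0); rewrite -absvalM !divff// absval1.
Qed.

Lemma absval_sum a (I : Type) (s : seq I) (F : I -> K) :
  a (\sum_(i <- s) F i) <= \sum_(i <- s) a (F i).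
Proof.
elim: s => [|i s IH]; first by rewrite !big_nil absval0.
by rewrite !big_cons (le_trans (absval_triangle _ _ _)) ?lerD2l.
Qed.

Lemma absval_lower a x y : a x - a y <= a (x + y).
Proof.
rewrite lerBlDr -{1}(addrK y x) -[a y]absvalN; exact: absval_triangle.
Qed.

Lemma absval_lt1_witness a : exists2 x, x != 0 & a x < 1.
Proof.
have [x x0] := absval_nontrivial a.
rewrite neq_lt => /orP[|x1]; first by exists x.
exists x^-1; rewrite ?invr_eq0// absvalV invf_lt1 //; exact: lt_trans x1.
Qed.

Lemma absval_gt1_witness a : exists x, 1 < a x.
Proof.
have [x x0 x1] := absval_lt1_witness a.
by exists x^-1; rewrite absvalV invf_gt1 ?absval_gt0.
Qed.

Lemma open_absP a (A : set K) : @open (abs_space a) A <->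
  forall x, A x -> exists2 e, 0 < e & forall y, a (x - y) < e -> A y.
Proof.
rewrite openE; split=> [oA x /oA|H x /H [e e0 eA]].
  by rewrite /interior -nbhs_ballE => -[e /= e0 eA]; exists e.
by rewrite /interior -nbhs_ballE; exists e.
Qed.

(** Fix p with 0 < |p|_a < 1, hence |p|_b < 1. The balls of radius |p|^n form a
    neighbourhood basis of 0 for both absolute values. Applied to quotients by
    powers of p the hypothesis compares these balls, once directly and once,
    with a loss of one power of p, through its contrapositive for inverses. *)
Lemma absval_equivP a b : (forall x, a x < 1 -> b x < 1) -> absval_equiv a b.
Proof.
move=> ab.
have [p p0 pa] := absval_lt1_witness a.
have small c q (e : R) : q != 0 -> c q < 1 -> 0 < e -> exists n, c q ^+ n < e.
  move=> q0 cq e0.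
  have /cvgrPdist_lt/(_ e e0) : (fun n => c q ^+ n) @ \oo --> (0 : R).
    by apply: cvg_expr; rewrite ger0_norm ?absval_ge0.
  move=> /filter_ex[n]; rewrite sub0r normrN ger0_norm ?exprn_ge0 ?absval_ge0//.
  by exists n.
have pb := ab _ pa.
apply/asboolP => A; rewrite !open_absP; split=> H x /H[e e0 eA].
  have [n ne] := small a p e p0 pa e0.
  exists (b p ^+ n.+1); first by rewrite exprn_gt0// absval_gt0.
  move=> y; rewrite -absvalX => xy; apply: eA; apply: le_lt_trans ne.
  rewrite leNgt; apply/negP => lt; move: xy; apply/negP; rewrite -leNgt ltW//.
  have xy0 : x - y != 0.
    by apply: contraTneq lt => ->; rewrite absval0 -leNgt exprn_ge0// absval_ge0.
  rewrite -[ltRHS]mul1r -ltr_pdivrMr ?absval_gt0// -absvalV -absvalM; apply: ab.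
  rewrite absvalM absvalV ltr_pdivrMr ?absval_gt0// mul1r absvalX.
  apply: le_lt_trans lt; rewrite exprS ger_pMl ?ltW// exprn_gt0// absval_gt0//.
have [n ne] := small b p e p0 pb e0.
exists (a p ^+ n); first by rewrite exprn_gt0// absval_gt0.
move=> y xy; apply: eA; apply: lt_trans ne; rewrite -absvalX.
have pn0 : p ^+ n != 0 by rewrite expf_neq0.
rewrite -[ltRHS]mul1r -ltr_pdivrMr ?absval_gt0// -absvalV -absvalM; apply: ab.
by rewrite absvalM absvalV ltr_pdivrMr ?absval_gt0// mul1r absvalX.
Qed.

Lemma absval_separate2 a b : ~~ absval_equiv a b ->
  exists x, 1 < a x /\ b x < 1.
Proof.
move=> nab.
have nba : ~~ absval_equiv b a.
  by apply: contra nab => /asboolP H; apply/asboolP => A; split=> /H.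
have aux c d : ~~ absval_equiv c d -> exists x, c x < 1 /\ 1 <= d x.
  move=> ncd; apply: contrapT => H; move/negP: ncd; apply; apply: absval_equivP.
  by move=> x cx; rewrite ltNge; apply/negP => dx; apply: H; exists x.
have [x [ax bx]] := aux a b nab; have [y [by_ ay]] := aux b a nba.
have x0 : x != 0.
  by apply: contraTneq bx => ->; rewrite absval0 -ltNge ltr01.
exists (y / x); rewrite !absvalM !absvalV; split.
  by rewrite ltr_pdivlMr ?absval_gt0// mul1r (lt_le_trans ax).
by rewrite ltr_pdivrMr ?absval_gt0// mul1r (lt_le_trans by_).
Qed.

Lemma near_powers_small (q e : R) : 0 <= q < 1 -> 0 < e ->
  \forall n \near \oo, q ^+ n < e.
Proof.
move=> /andP[q0 q1] e0.
have /cvgrPdist_lt/(_ e e0) : (fun n => q ^+ n) @ \oo --> (0 : R).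
  by apply: cvg_expr; rewrite ger0_norm.
by apply: filterS => n; rewrite sub0r normrN ger0_norm ?exprn_ge0.
Qed.

Lemma near_seq (I : eqType) (s : seq I) (P : I -> nat -> Prop) :
  (forall i, i \in s -> \forall n \near \oo, P i n) ->
  \forall n \near \oo, forall i, i \in s -> P i n.
Proof.
elim: s => [|i s IH] H; first by near=> n.
apply: filterS2 (H i (mem_head _ _)) (IH _) => [n Pi Ps j|j js].
  by rewrite in_cons => /predU1P[->//|]; exact: Ps.
by apply: H; rewrite in_cons js orbT.
Unshelve. all: by end_near. Qed.

(** The numbers x^n / (1 + x^n) tend to 0 where |x| < 1 and to 1 where
    |x| > 1. *)
Lemma near_ratio_small a x (e : R) : a x < 1 -> 0 < e ->
  \forall n \near \oo, 1 + x ^+ n != 0 /\ a (x ^+ n / (1 + x ^+ n)) < e.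
Proof.
move=> ax e0.
have e' : 0 < e / (1 + e) by rewrite divr_gt0// addr_gt0.
have ax' : 0 <= a x < 1 by rewrite absval_ge0.
apply: filterS (near_powers_small ax' e') => n.
rewrite -absvalX; set z := x ^+ n => zs.
have h : a z * (1 + e) < e by rewrite -ltr_pdivlMr// addr_gt0.
have az0 := absval_ge0 a z.
have h2 : 1 - a z <= a (1 + z) by have := absval_lower a 1 z; rewrite absval1.
have h3 : 0 < a (1 + z) by apply: lt_le_trans h2; nra.
have z0 : 1 + z != 0 by apply: contraTneq h3 => ->; rewrite absval0 ltxx.
split => //; rewrite absvalM absvalV ltr_pdivrMr//.
by apply: lt_le_trans (_ : e * (1 - a z) <= _); [lra|rewrite ler_pM2l].
Qed.

Lemma near_ratio_neq0 a x : 1 < a x -> \forall n \near \oo, 1 + x ^+ n != 0.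
Proof.
move=> ax; have x0 : x != 0.
  by apply: contraTneq ax => ->; rewrite absval0 -leNgt ler01.
have ax' : a x^-1 < 1 by rewrite absvalV invf_lt1 ?absval_gt0.
apply: filterS (near_ratio_small ax' ltr01) => n [+ _]; apply: contra_neq.
rewrite exprVn => h; apply: (mulfI (expf_neq0 n x0)).
by rewrite mulr0 mulrDr mulr1 mulfV ?expf_neq0// addrC.
Qed.

Lemma near_ratio_one a x (e : R) : 1 < a x -> 0 < e ->
  \forall n \near \oo, 1 + x ^+ n != 0 -> a (x ^+ n / (1 + x ^+ n) - 1) < e.
Proof.
move=> ax e0; have x0 : x != 0.
  by apply: contraTneq ax => ->; rewrite absval0 -leNgt ler01.
have ax' : a x^-1 < 1 by rewrite absvalV invf_lt1 ?absval_gt0.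
apply: filterS (near_ratio_small ax' e0) => n [n1 n2] n3.
apply: le_lt_trans n2; rewrite -absvalN exprVn.
have y0 : x ^+ n != 0 by rewrite expf_neq0.
rewrite exprVn in n1.
rewrite le_eqVlt; apply/orP; left; apply/eqP; congr (a _).
have n4 : x ^+ n + 1 != 0 by rewrite addrC.
field; rewrite y0 /= n4 //=.
Qed.

Lemma exists_scale (C e : R) : 0 <= C -> 0 < e -> exists2 d : R, 0 < d & d * C < e.
Proof.
move=> C0 e0; exists (e / (C + 1)); first by rewrite divr_gt0// ltr_wpDl.
by rewrite mulrAC ltr_pdivrMr ?ltr_wpDl// mulrDr mulr1 ltrDl.
Qed.

Variables (I : eqType) (A : I -> absval R K).

(** Artin and Whaples: given x for the old places and y separating A i from
    A j, use x^n y if |x|_j <= 1 and y x^n / (1 + x^n) otherwise. *)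
Lemma absval_separate (i : I) (s : seq I) :
  (forall j, j \in s -> ~~ absval_equiv (A i) (A j)) ->
  exists x, 1 < A i x /\ forall j, j \in s -> A j x < 1.
Proof.
elim: s => [|j s IH] H.
  by have [x x1] := absval_gt1_witness (A i); exists x.
have [|x [ix sx]] := IH.
  by move=> l ls; apply: H; rewrite in_cons ls orbT.
have [y [iy jy]] := absval_separate2 (H j (mem_head _ _)).
have [jx|jx] := leP (A j x) 1.
  have : \forall n \near \oo, forall l, l \in s -> A l (x ^+ n * y) < 1.
    apply: near_seq => l ls.
    have [d d0 dE] := exists_scale (absval_ge0 (A l) y) ltr01.
    have q : 0 <= A l x < 1 by rewrite absval_ge0 sx.
    apply: filterS (near_powers_small q d0) => n; rewrite absvalM absvalX => h.
    by apply: le_lt_trans dE; apply: ler_wpM2r; [exact: absval_ge0|exact: ltW].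
  move=> /filter_ex[n Hn]; exists (x ^+ n * y); split.
    rewrite absvalM absvalX; apply: lt_le_trans iy _.
    by rewrite ler_peMl ?absval_ge0// exprn_ege1// ltW.
  move=> l; rewrite in_cons => /predU1P[->|]; last exact: Hn.
  rewrite absvalM absvalX; apply: le_lt_trans jy.
  by rewrite ler_piMl ?absval_ge0// exprn_ile1// absval_ge0.
have [di di0 diE] : exists2 d : R, 0 < d & d * A i y < A i y - 1.
  by apply: exists_scale; [exact: absval_ge0|rewrite subr_gt0].
have [dj dj0 djE] : exists2 d : R, 0 < d & d * A j y < 1 - A j y.
  by apply: exists_scale; [exact: absval_ge0|rewrite subr_gt0].
have Hs : \forall n \near \oo, forall l, l \in s ->
    A l (x ^+ n / (1 + x ^+ n) * y) < 1.
  apply: near_seq => l ls.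
  have [d d0 dE] := exists_scale (absval_ge0 (A l) y) ltr01.
  apply: filterS (near_ratio_small (sx l ls) d0) => n [_ h]; rewrite absvalM.
  by apply: le_lt_trans dE; apply: ler_wpM2r; [exact: absval_ge0|exact: ltW].
have Hi := near_ratio_one ix di0; have Hj := near_ratio_one jx dj0.
have nz := near_ratio_neq0 ix.
have [n [[Hsn nzn] [Hin Hjn]]] :=
  filter_ex (filterI (filterI Hs nz) (filterI Hi Hj)).
set u := x ^+ n / (1 + x ^+ n) in Hsn Hin Hjn.
have {}Hin := Hin nzn; have {}Hjn := Hjn nzn.
have uy : u * y = y + (u - 1) * y by ring.
exists (u * y); split.
  rewrite uy; apply: lt_le_trans (absval_lower _ _ _); rewrite absvalM.
  rewrite ltrBrDr addrC -ltrBrDr; apply: le_lt_trans diE.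
  by apply: ler_wpM2r; [exact: absval_ge0|exact: ltW].
move=> l; rewrite in_cons => /predU1P[->|]; last exact: Hsn.
rewrite uy; apply: le_lt_trans (absval_triangle _ _ _) _; rewrite absvalM.
rewrite addrC -ltrBrDr; apply: le_lt_trans djE.
by apply: ler_wpM2r; [exact: absval_ge0|exact: ltW].
Qed.

Lemma approximate_one (i : I) (s : seq I) (t : K) (e : R) : 0 < e ->
  (forall j, j \in s -> ~~ absval_equiv (A i) (A j)) ->
  exists w, A i (w - t) < e /\ forall j, j \in s -> A j w < e.
Proof.
move=> e0 H; have [x [ix sx]] := absval_separate H.
have small (c : absval R K) u (d : R) : d * c t < e -> c u < d -> c (u * t) < e.
  move=> h1 h2; rewrite absvalM; apply: le_lt_trans h1.
  by apply: ler_wpM2r; [exact: absval_ge0|exact: ltW].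
have Hs : \forall n \near \oo, forall j, j \in s ->
    A j (x ^+ n / (1 + x ^+ n) * t) < e.
  apply: near_seq => l ls.
  have [d d0 dE] := exists_scale (absval_ge0 (A l) t) e0.
  by apply: filterS (near_ratio_small (sx l ls) d0) => n [_]; exact: small.
have [d d0 dE] := exists_scale (absval_ge0 (A i) t) e0.
have Hi := near_ratio_one ix d0.
have [n [Hsn [Hin nz]]] := filter_ex (filterI Hs (filterI Hi (near_ratio_neq0 ix))).
exists (x ^+ n / (1 + x ^+ n) * t); split => //.
rewrite -[X in _ - X]mul1r -mulrBl; exact: small dE (Hin nz).
Qed.

Lemma weak_approximation (s : seq I) (t : I -> K) (e : R) : uniq s -> 0 < e ->
  {in s &, forall i j, i != j -> ~~ absval_equiv (A i) (A j)} ->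
  exists x, forall i, i \in s -> A i (x - t i) < e.
Proof.
move=> us e0 H.
pose e' := e / (size s).+1%:R.
have e'0 : 0 < e' by rewrite divr_gt0.
have step i : exists w, i \in s ->
    A i (w - t i) < e' /\ forall j, j \in s -> j != i -> A j w < e'.
  have [si|_] := boolP (i \in s); last by exists 0.
  have [|w [w1 w2]] := @approximate_one i (rem i s) (t i) e' e'0.
    move=> j; rewrite mem_rem_uniq// inE => /andP[ji js].
    by apply: H => //; rewrite eq_sym.
  exists w => _; split => // j js ji; apply: w2.
  by rewrite mem_rem_uniq// inE ji.
have [w wP] := choice step.
exists (\sum_(i <- s) w i) => j js.
have -> : \sum_(i <- s) w i - t j = \sum_(i <- s) (w i - (i == j)%:R * t i).
  rewrite sumrB; congr (_ - _); rewrite (bigD1_seq j)//= eqxx mul1r big1 ?addr0//.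
  by move=> i /negbTE ->; rewrite mul0r.
apply: le_lt_trans (absval_sum _ _ _) _.
apply: (@le_lt_trans _ _ (\sum_(i <- s) e')).
  rewrite big_seq_cond [leRHS]big_seq_cond; apply: ler_sum => i; rewrite andbT => si.
  have [ij|ij] := eqVneq i j.
    by rewrite -ij mul1r ltW//; have [] := wP i si.
  by rewrite mul0r subr0 ltW//; have [_] := wP i si; apply => //; rewrite eq_sym.
rewrite big_const_seq count_predT iter_addr_0 -mulr_natr /e' mulrAC.
rewrite ltr_pdivrMr// ltr_pM2l// ltr_nat//.
Qed.

End AbsVal.

(** * Absolute values of a number field on the integers *)

Section Ostrowski.
Variables (R : realType) (k : fieldExtType rat).
Implicit Types a : absval R k.

(** By binary expansion, the triangle inequality bounds |n| by the number of
    digits of n. *)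
Lemma absval_nat_log a n l : a 2%:R <= 1 -> (n < 2 ^ l)%N -> a n%:R <= l%:R.
Proof.
move=> a2; elim: l n => [|l IH] n.
  by rewrite expn0 ltnS leqn0 => /eqP ->; rewrite absval0.
move=> nl; rewrite -(odd_double_half n) natrD -mul2n natrM -[l.+1%:R]natr1 [X in a X]addrC.
apply: le_trans (absval_triangle _ _ _) _; apply: lerD.
  rewrite absvalM; apply: le_trans (IH n./2 _); last first.
    by move: nl; rewrite expnS; lia.
  by rewrite ler_piMl ?absval_ge0.
by case: odd; rewrite ?absval1 ?absval0.
Qed.

Lemma powers_unbounded (t : R) (C D : R) : 1 < t -> exists m : nat, C * m%:R + D < t ^+ m.
Proof.
move=> t1; pose u := t - 1; have u0 : 0 < u by rewrite subr_gt0.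
have bern m : 1 + u * m%:R <= t ^+ m.
  elim: m => [|m IH]; first by rewrite mulr0 addr0.
  have tE : 1 + u = t by rewrite /u; ring.
  have h : t * (1 + u * m%:R) <= t * t ^+ m by rewrite ler_pM2l// -tE addr_gt0.
  rewrite exprS -natr1; apply: le_trans h.
  by rewrite -[X in _ <= X * _]tE; have := ler0n R m; nra.
pose B := (`|C| *+ 2 + `|D|) / (u ^+ 2).
pose m := (Num.bound B).+1.
have mB : B < m%:R.
  have := @archi_boundP R B; rewrite /m -natr1 => h.
  apply: lt_trans (_ : (Num.bound B)%:R < _); last by rewrite ltrDl.
  by apply: h; rewrite divr_ge0 ?addr_ge0 ?mulrn_wge0 ?exprn_ge0// ltW.
exists (m + m)%N; rewrite exprD.
have m1 : 1 <= m%:R :> R by rewrite ler1n.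
have h1 : (u * m%:R) ^+ 2 <= t ^+ m * t ^+ m.
  rewrite expr2 ler_pM ?mulr_ge0 ?ler0n ?(ltW u0)//.
    by apply: le_trans (bern m); rewrite lerDr.
  by apply: le_trans (bern m); rewrite lerDr.
apply: lt_le_trans h1.
move: mB; rewrite /B ltr_pdivrMr ?exprn_gt0// => mB.
rewrite exprMn natrD.
have hC := ler_norm C; have hD := ler_norm D; have hD0 := normr_ge0 D.
have hC0 := normr_ge0 C.
apply: le_lt_trans (_ : (`|C| *+ 2 + `|D|) * m%:R < _).
  by rewrite mulr2n; nra.
rewrite [m%:R ^+ 2]expr2 mulrA.
by rewrite ltr_pM2r ?ltr0n// mulrC.
Qed.

(** The powers n^m have only about m log n digits, so |n| > 1 is impossible. *)
Lemma absval_nat_le1 a n : a 2%:R <= 1 -> a n%:R <= 1.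
Proof.
move=> a2; rewrite leNgt; apply/negP => an.
have [m] := powers_unbounded n%:R 1 an; rewrite -absvalX -natrX ltNge.
rewrite -natrM natr1 => /negP; apply; apply: absval_nat_log => //.
rewrite expnS expnM; apply: leq_ltn_trans (_ : (2 ^ n) ^ m < _)%N.
  by case: (posnP m) => [->|m0]; rewrite ?expn0// leq_exp2r// ltnW// ltn_expl.
by rewrite ltn_Pmull// expn_gt0 expn_gt0.
Qed.

(** The archimedean alternative, and what replaces the ultrametric inequality in
    the other one. If |d| = 1 for all d > 0, an integer equation of degree at
    most [k : Q] with |x| > 1 bounds |x| by [k : Q]; applied to the powers of
    some x this contradicts nontriviality. *)
Lemma absval_cases a : 1 < a 2%:R \/
  (forall n : nat, a n%:R <= 1) /\ exists2 d : nat, (0 < d)%N & a d%:R < 1.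
Proof.
have [a2|a2] := leP (a 2%:R) 1; [right|by left].
split=> [n|]; first exact: absval_nat_le1.
apply: contrapT => H.
have an1 n : (0 < n)%N -> a n%:R = 1.
  move=> n0; apply/eqP; rewrite eq_le absval_nat_le1//= leNgt; apply/negP => an.
  by apply: H; exists n.
have az (z : int) : z != 0 -> a z%:~R = 1.
  case/intP: z => // n _; first exact: an1.
  by rewrite rmorphN absvalN; exact: an1.
have az1 (z : int) : a z%:~R <= 1.
  by have [->|/az ->//] := eqVneq z 0; rewrite absval0.
have bound y : 1 <= a y -> a y <= (\dim {:k})%:R.
  move=> ay; have [p [p0 py sp]] := int_poly_root y.
  have y0 : 0 < a y by apply: lt_le_trans ay.
  move: py; rewrite (horner_int_poly y (leqnn _)).
  have : (0 < size p)%N by rewrite size_poly_gt0.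
  case E : (size p) => [//|m] _; rewrite big_ord_recr /= => /eqP.
  rewrite addrC addr_eq0 => /eqP /(congr1 a).
  have -> : p`_m = lead_coef p by rewrite lead_coefE E.
  rewrite absvalM az ?lead_coef_eq0// mul1r absvalN absvalX => e.
  have [m0|m0] := posnP m.
    by move: e; rewrite m0 big_ord0 absval0 expr0 => /eqP; rewrite oner_eq0.
  apply: (@le_trans _ _ m%:R); last by rewrite ler_nat -ltnS -E.
  have : a y ^+ m <= m%:R * a y ^+ m.-1.
    rewrite e; apply: le_trans (absval_sum _ _ _) _.
    apply: (@le_trans _ _ (\sum_(i < m) a y ^+ m.-1)).
      apply: ler_sum => i _; rewrite absvalM absvalX.
      apply: le_trans (_ : a y ^+ i <= _); first by rewrite ler_piMl ?az1 ?exprn_ge0 ?absval_ge0.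
      by rewrite ler_weXn2l//; have := ltn_ord i; lia.
    by rewrite sumr_const card_ord mulr_natl.
  by rewrite -{1}(prednK m0) exprSr mulrC ler_pM2r ?exprn_gt0// mulrC.
have [x x1] := absval_gt1_witness a.
have [m] := powers_unbounded 0 (\dim {:k})%:R x1.
rewrite mul0r add0r -absvalX ltNge => /negP; apply; apply: bound.
by rewrite absvalX exprn_ege1// ltW.
Qed.

Lemma common_small_nat (s : seq (absval R k)) (d0 : nat) : (0 < d0)%N ->
  exists d : nat, [/\ (0 < d)%N, (d0 %| d)%N &
    forall a, a \in s -> 1 < a 2%:R \/ (forall n : nat, a n%:R <= 1) /\ a d%:R < 1].
Proof.
move=> d00; elim: s => [|a s [d [d_gt0 dd H]]]; first by exists d0.
have [a2|[an [e e0 ae]]] := absval_cases a.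
  by exists d; split => // b; rewrite in_cons => /predU1P[->|/H//]; left.
exists (d * e)%N; split; [by rewrite muln_gt0 d_gt0|exact: dvdn_mulr|].
move=> b; rewrite in_cons => /predU1P[->|/H[?|[bn bd]]]; [|by left|].
  right; split => //; rewrite natrM absvalM; apply: le_lt_trans ae.
  by rewrite ler_piMl ?absval_ge0.
right; split => //; rewrite natrM absvalM; apply: le_lt_trans bd.
by rewrite ler_piMr ?absval_ge0.
Qed.

(** Where |d| < 1, the denominator has absolute value at least 1 - |d| for all t,
    so a large j is enough there; j is fixed before t = 2^l is chosen for the
    places with |2| > 1. *)
Lemma small_ratio (s : seq (absval R k)) (d n : nat) (z : k) (e : R) :
  (0 < d)%N -> (0 < n)%N -> 0 < e ->
  (forall a, a \in s -> 1 < a 2%:R \/ (forall n : nat, a n%:R <= 1) /\ a d%:R < 1) ->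
  exists j t : nat, (0 < j)%N /\ forall a, a \in s ->
    a (d%:R ^+ j * z / (1 + d * n * t)%:R) < e.
Proof.
move=> d0 n0 e0 H.
have [j [j0 Hj]] : exists j : nat, (0 < j)%N /\ forall a, a \in s -> ~ 1 < a 2%:R ->
    a d%:R ^+ j * a z / (1 - a d%:R) < e.
  have : \forall j \near \oo, forall a, a \in s -> ~ 1 < a 2%:R ->
      a d%:R ^+ j * a z / (1 - a d%:R) < e.
    apply: near_seq => a /H [a2|[_ ad]]; first by near=> j.
    have ad1 : 0 < 1 - a d%:R by rewrite subr_gt0.
    have [c c0 cE] := exists_scale (absval_ge0 a z) (mulr_gt0 e0 ad1).
    have q : 0 <= a d%:R < 1 by rewrite absval_ge0.
    apply: filterS (near_powers_small q c0) => j jc _.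
    rewrite ltr_pdivrMr//; apply: le_lt_trans cE.
    by apply: ler_wpM2r; [exact: absval_ge0|exact: ltW].
  move=> h; have [j [Hj j0]] := filter_ex (filterI h (nbhs_infty_gt 0%N)).
  by exists j.
set w := d%:R ^+ j * z.
have [t Ht] : exists t : nat, forall a, a \in s -> 1 < a 2%:R ->
    a w / e + 1 < a (d * n)%:R * a 2%:R ^+ t.
  have : \forall t \near \oo, forall a, a \in s -> 1 < a 2%:R ->
    a w / e + 1 < a (d * n)%:R * a 2%:R ^+ t.
    apply: near_seq => a _.
    have [a2|a2] := leP (a 2%:R) 1; first by near=> t.
    have dn0 : 0 < a (d * n)%:R by rewrite absval_gt0// natk_neq0// muln_gt0 d0.
    have B0 : 0 < a w / e + 1 by rewrite ltr_wpDl// divr_ge0 ?absval_ge0// ltW.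
    have i2 : 0 <= (a 2%:R)^-1 < 1.
      by rewrite invr_ge0 absval_ge0 invf_lt1// (lt_trans ltr01).
    have c0 : 0 < a (d * n)%:R / (a w / e + 1) by rewrite divr_gt0.
    apply: filterS (near_powers_small i2 c0) => t h _.
    move: h; rewrite exprVn ltr_pdivlMr// mulrC ltr_pdivrMr// exprn_gt0//.
    exact: lt_trans a2.
  by move=> /filter_ex[t Ht]; exists t.
exists j, (2 ^ t)%N; split => // a sa.
have m0 : 0 < a (1 + d * n * 2 ^ t)%:R by rewrite absval_gt0// natk_neq0.
rewrite -/w absvalM absvalV ltr_pdivrMr// [e * _]mulrC -ltr_pdivrMr//.
have [a2|[an ad]] := H a sa.
  apply: lt_le_trans (_ : a (d * n)%:R * a 2%:R ^+ t - 1 <= _).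
    by rewrite ltrBrDr; exact: Ht.
  rewrite natrD [1%:R + _]addrC (natrM _ (d * n)) natrX -absvalX -absvalM -[X in _ - X](absval1 a).
  exact: absval_lower.
have na2 : ~ 1 < a 2%:R by apply/negP; rewrite -leNgt an.
have ad1 : 0 < 1 - a d%:R by rewrite subr_gt0.
apply: lt_le_trans (_ : 1 - a d%:R <= _).
  have := Hj a sa na2; rewrite ltr_pdivrMr// => h.
  by rewrite ltr_pdivrMr// mulrC /w absvalM absvalX.
rewrite natrD; apply: le_trans (absval_lower _ _ _); rewrite absval1 lerB//.
by rewrite -mulnA natrM absvalM ler_piMr ?absval_ge0.
Unshelve. all: by end_near. Qed.

End Ostrowski.

(** * Ideals of maximal minors *)

Section IdealGen.
Variable k : fieldExtType rat.
Local Notation O := (@ring_of_integers k).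

Lemma submod_ideal_gen (I : finType) (q : I -> k) : submod (ideal_gen q).
Proof.
split=> [|_ _ [c Oc ->] [d Od ->]|a _ Oa [c Oc ->]].
- by exists (fun=> 0) => [i|]; [exact: ringint0|rewrite big1// => i _; rewrite mul0r].
- exists (fun i => c i + d i) => [i|]; first exact: ringintD.
  by rewrite -big_split; apply: eq_bigr => i _; rewrite mulrDl.
- exists (fun i => a * c i) => [i|]; first exact: ringintM.
  by rewrite mulr_sumr; apply: eq_bigr => i _; rewrite mulrA.
Qed.

Lemma ideal_gen_mem (I : finType) (q : I -> k) i : ideal_gen q (q i).
Proof.
exists (fun j => (j == i)%:R) => [j|]; first exact: ringint_nat.
by rewrite (bigD1 i)//= eqxx mul1r big1 ?addr0// => j /negbTE ->; rewrite mul0r.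
Qed.

Lemma ideal_gen_min (I : finType) (q : I -> k) (P : set k) :
  submod P -> (forall i, P (q i)) -> ideal_gen q `<=` P.
Proof.
move=> sP Pq _ [c Oc ->]; apply: submod_sum => // i _.
by case: sP => _ _; apply.
Qed.

(** [family_invertible] wants a nonzero generator in front. *)
Lemma ideal_gen_invertible (I : finType) (q : I -> k) :
  (exists2 x, ideal_gen q x & x != 0) -> invertible (ideal_gen q).
Proof.
move=> [x [c _ xE] x0]; split; first exact: submod_ideal_gen.
have [i1 qi1] : exists i, q i != 0.
  apply: contrapT => H; move: x0; rewrite xE big1 ?eqxx// => i _.
  have [->|qi] := eqVneq (q i) 0; first by rewrite mulr0.
  by case: H; exists i.
pose s := i1 :: rem i1 (enum I).
have ps : perm_eq (enum I) s by rewrite perm_to_rem// mem_enum.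
have [u [Ou u1]] := @family_invertible k (size (rem i1 (enum I)))
  (fun n => q (nth i1 s n)) qi1.
exists [seq (q i, u (index i s)) | i <- s]; split.
  move=> _ /mapP[i si ->] /=; split; first exact: ideal_gen_mem.
  have : submod [set g | O (g * u (index i s))].
    split=> [|g h /= Og Oh|a g Oa /= Og]; rewrite /= ?mul0r ?mulrDl -?mulrA.
    - exact: ringint0.
    - exact: ringintD.
    - exact: ringintM.
  move=> sP; apply: (ideal_gen_min sP) => j /=.
  have sj : j \in s by rewrite -(perm_mem ps) mem_enum.
  rewrite -{1}(nth_index i1 sj).
  have idx l : l \in s -> (index l s <= size (rem i1 (enum I)))%N.
    by rewrite -index_mem.
  by apply: Ou; exact: idx.
rewrite big_map (big_nth i1) big_mkord -[RHS]u1; apply: eq_bigr => i _.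
rewrite [LHS]/(q _ * u _) index_uniq //; last by rewrite -(perm_uniq ps) enum_uniq.
Qed.

Lemma common_denominator (I : finType) (q : I -> k) :
  exists2 d : nat, (0 < d)%N & forall i, O (d%:R * q i).
Proof.
suff [d d0 H] : exists2 d : nat, (0 < d)%N & forall i, i \in enum I -> O (d%:R * q i).
  by exists d => // i; apply: H; rewrite mem_enum.
elim: (enum I) => [|i s [d d0 H]]; first by exists 1%N.
have [e e0 Oe] := denominator (q i).
exists (d * e)%N => [|j]; first by rewrite muln_gt0 d0.
rewrite in_cons natrM => /predU1P[->|/H Oj].
  by rewrite -mulrA; apply: ringintM => //; exact: ringint_nat.
by rewrite mulrAC mulrC; apply: ringintM => //; exact: ringint_nat.
Qed.

End IdealGen.

Section Minors.
Variables (K : fieldType) (r N : nat).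
Implicit Types (M : 'M[K]_(r, N)) (f : 'I_r -> 'I_N).

(** Column choices need not be increasing, so that exchanging one chosen column
    for another stays inside the same family; injective choices give the
    Plucker coordinates up to sign and the others give zero. *)
Definition minor M f := \det (colsub f M).

Lemma column_enum_inj (I : plucker_index r N) : injective (column_enum I).
Proof.
move=> i j; case: (ltngtP i j) => [ij|ij|/val_inj//] e.
  by have := column_enum_homo I ij; rewrite e ltnn.
by have := column_enum_homo I ij; rewrite e ltnn.
Qed.

Lemma minor_noninj M f : ~ injective f -> minor M f = 0.
Proof.
move=> nf; have /injectivePn[i [j ij fij]] : ~~ injectiveb f by apply/negP => /injectiveP.
rewrite /minor -det_tr; apply: (determinant_alternate ij) => l.
by rewrite !mxE fij.
Qed.

Lemma minor_plucker M f : injective f ->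
  exists (I : plucker_index r N) (b : bool), minor M f = (-1) ^+ b * plucker M I.
Proof.
move=> finj.
have hI : #|[set f j | j : 'I_r]%SET| == r by rewrite card_imset// card_ord.
pose I : plucker_index r N := exist (fun I : {set 'I_N} => #|I| == r) _ hI.
have hE j : exists i, f j = column_enum I i.
  have : f j \in val I by apply: imset_f.
  by rewrite -column_enum_im => /imsetP[i _ ->]; exists i.
have [s sE] := choice hE.
have sinj : injective s by move=> i j sij; apply: finj; rewrite !sE sij.
pose p := perm sinj.
exists I, (odd_perm p^-1); rewrite plucker_minor /minor.
have -> : colsub f M = col_perm p (colsub (column_enum I) M).
  by apply/matrixP => i j; rewrite !mxE sE permE.
by rewrite col_permE det_mulmx det_perm mulrC.
Qed.

(** Only column j0 changes, by x times the unit vector number i0, and column l0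
    of M is that unit vector; so the determinant expands linearly in the column
    f a = j0. *)
Lemma minor_perturb M (x : K) (i0 : 'I_r) (j0 l0 : 'I_N) f :
  (forall i, M i l0 = (i == i0)%:R) -> injective f ->
  let M' := M + x *: delta_mx i0 j0 in
  forall a, f a = j0 ->
    minor M' f = minor M f + x * minor M (fun i => if i == a then l0 else f i).
Proof.
move=> Ml0 finj M' a fa; set g := fun i => _.
rewrite /minor -det_tr -[in RHS]det_tr -[X in _ + _ * X]det_tr.
rewrite (@determinant_multilinear _ _ _ (colsub f M)^T (colsub g M)^T a 1 x) ?mul1r//.
- by apply/rowP => i; rewrite !mxE /g eqxx fa Ml0 eqxx andbT mul1r.
- apply/matrixP => i j; rewrite !mxE -fa (inj_eq finj).
  by rewrite [lift a _ == a]eq_sym (negbTE (neq_lift _ _)) andbF mulr0 addr0.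
apply/matrixP => i j; rewrite !mxE -fa (inj_eq finj) /g.
by rewrite [lift a _ == a]eq_sym (negbTE (neq_lift _ _)) andbF mulr0 addr0.
Qed.

Lemma minor_perturb_avoid M (x : K) (i0 : 'I_r) (j0 : 'I_N) f :
  (forall i, f i != j0) -> minor (M + x *: delta_mx i0 j0) f = minor M f.
Proof.
move=> fj; congr (\det _); apply/matrixP => i j; rewrite !mxE.
by rewrite (negbTE (fj j)) andbF mulr0 addr0.
Qed.

End Minors.

Section PluckerIdeal.
Variables (k : fieldExtType rat) (r N : nat).
Local Notation O := (@ring_of_integers k).
Local Notation PI M := (ideal_gen (plucker M)).

Lemma minor_in_plucker_ideal (M : 'M[k]_(r, N)) (f : 'I_r -> 'I_N) : PI M (minor M f).
Proof.
have sM := submod_ideal_gen (plucker M).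
have [/(minor_plucker M)[I [b ->]]|/minor_noninj ->] := pselect (injective f).
  by case: sM => _ _; apply; [apply: ringintX; apply: ringintN; exact: ringint1|exact: ideal_gen_mem].
by case: sM.
Qed.

Lemma plucker_is_minor (M : 'M[k]_(r, N)) I : plucker M I = minor M (column_enum I).
Proof. exact: plucker_minor. Qed.

(** The three conclusions together say that A(M') = A(M) (O + O x), where A(M)
    and A(M') are the ideals of maximal minors. Write m and m' for the
    minors of M and M' in the same columns; m' = m + x n, where n is
    a minor of M avoiding column j0, hence also a minor of M'. Since
    1 = a + d b,
      m = a m' - (a x) n + b (d m),
    and a x, d m are integral while 1 is a minor of M'; so A(M) is
    contained in A(M'). The number x itself is the difference of the minors of
    M' and M that are their entries at (i0, j0), and x m = (a x) m + b (d m) x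
    is then in A(M') as well. *)
Lemma plucker_ideal_perturb (M : 'M[k]_(r, N)) (h : 'I_r -> 'I_N)
    (i0 : 'I_r) (j0 : 'I_N) (x a b : k) (d : nat) :
  injective h -> (forall i, h i != j0) -> colsub h M = 1%:M ->
  (forall I, O (d%:R * plucker M I)) ->
  O a -> O b -> O (a * x) -> a + d%:R * b = 1 ->
  let M' := M + x *: delta_mx i0 j0 in
  [/\ PI M `<=` PI M', forall w, PI M w -> PI M' (x * w) &
      forall I, exists u v, [/\ PI M u, PI M v & plucker M' I = u + x * v]].
Proof.
move=> hinj hj0 hM OdM Oa Ob Oax ab M'.
have sM := submod_ideal_gen (plucker M); have [M0 MD MM] := sM.
have sM' := submod_ideal_gen (plucker M'); have [M'0 M'D M'M] := sM'.
have Ml0 i : M i (h i0) = (i == i0)%:R.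
  by move/matrixP/(_ i i0): hM; rewrite !mxE.
have Od w : PI M w -> O (d%:R * w).
  apply: (@ideal_gen_min _ _ _ [set w | O (d%:R * w)]) => //.
  split=> [|u v /= Ou Ov|c u Oc /= Ou]; rewrite /= ?mulr0 ?mulrDr.
  - exact: ringint0.
  - exact: ringintD.
  - by rewrite mulrCA; exact: ringintM.
have hminor : minor M h = 1 by rewrite /minor hM det1.
have one_in : PI M' 1.
  by rewrite -hminor -(minor_perturb_avoid M x i0 hj0); exact: minor_in_plucker_ideal.
pose g f c (i : 'I_r) := if i == c then h i0 else f i : 'I_N.
have expand f c : injective f -> f c = j0 ->
    minor M' f = minor M f + x * minor M (g f c) /\ minor M (g f c) = minor M' (g f c).
  move=> finj fc; split; first exact: minor_perturb.
  apply/esym/minor_perturb_avoid => i; rewrite /g; case: (i =P c) => [_|/eqP ic]; first exact: hj0.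
  by rewrite -fc (inj_eq finj).
have dichotomy f : injective f -> (exists c, f c = j0) \/ minor M' f = minor M f.
  move=> finj; have [[c fc]|H] := pselect (exists c, f c = j0); first by left; exists c.
  right; apply: minor_perturb_avoid => i; apply/eqP => fi; apply: H.
  by exists i.
have minor_in f : injective f -> PI M' (minor M f).
  move=> finj; have [[c fc]|<-] := dichotomy f finj; last exact: minor_in_plucker_ideal.
  have [e1 e2] := expand f c finj fc.
  have -> : minor M f = a * minor M' f + (- (a * x)) * minor M' (g f c) +
      (b * (d%:R * minor M f)) * 1.
    rewrite -e2 e1 -[LHS]mul1r -{1}ab; ring.
  apply: (M'D); first apply: (M'D); apply: M'M; rewrite ?mulr1 //;
    try exact: minor_in_plucker_ideal; first exact: ringintN.
  by apply: ringintM => //; apply: Od; exact: minor_in_plucker_ideal.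
have sub : PI M `<=` PI M'.
  apply: ideal_gen_min => // I; rewrite plucker_is_minor; apply: minor_in.
  exact: column_enum_inj.
(* In these columns the minor is the entry at (i0, j0). *)
pose f1 i := if i == i0 then j0 else h i.
have f1inj : injective f1.
  move=> i j; rewrite /f1; case: eqP => [->|_]; case: eqP => [->|_] //.
  - by move=> e; have := hj0 j; rewrite -e eqxx.
  - by move=> e; have := hj0 i; rewrite e eqxx.
  - exact: hinj.
have x_in : PI M' x.
  have [|e1 _] := expand f1 i0 f1inj; first by rewrite /f1 eqxx.
  have gE : minor M (g f1 i0) = 1.
    rewrite -hminor; congr (\det _); apply/matrixP => i j; rewrite !mxE /g /f1.
    by case: eqP => [->|].
  have -> : x = minor M' f1 - minor M f1 by rewrite e1 gE; ring.
  by apply: submodB => //; [exact: minor_in_plucker_ideal|exact: minor_in].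
split=> // [w Mw|I].
  have -> : x * w = (a * x) * w + (b * (d%:R * w)) * x.
    by rewrite -[LHS]mul1r -{1}ab; ring.
  apply: M'D; apply: M'M => //; first exact: sub.
  by apply: ringintM => //; exact: Od.
have finj := @column_enum_inj r N I.
rewrite plucker_is_minor; have [[c fc]|->] := dichotomy _ finj.
  have [-> _] := expand _ _ finj fc.
  by eexists; eexists; split; last reflexivity; exact: minor_in_plucker_ideal.
by exists (minor M (column_enum I)), 0; split; [exact: minor_in_plucker_ideal| |rewrite mulr0 addr0].
Qed.

End PluckerIdeal.

(** * Moving the ideal class by changing one entry *)

Section ClassPerturbation.
Variables (k : fieldExtType rat) (r N : nat).
Local Notation O := (@ring_of_integers k).
Local Notation PI M := (ideal_gen (plucker M)).

(** [invertible_two_generated] is applied to the ideal G of all w with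
    A(M) w contained in A, which is A times the inverse of A(M). *)
Lemma class_perturbation (M : 'M[k]_(r, N)) (h : 'I_r -> 'I_N)
    (i0 : 'I_r) (j0 : 'I_N) (A : set k) (d : nat) :
  injective h -> (forall i, h i != j0) -> colsub h M = 1%:M ->
  is_fractional A -> (0 < d)%N -> (forall I, O (d%:R * plucker M I)) ->
  exists z n, (0 < n)%N /\ forall j t : nat, (0 < j)%N ->
    let x := d%:R ^+ j * z / (1 + d * n * t)%:R in
    exists2 c, c != 0 & PI (M + x *: delta_mx i0 j0) = [set c * w | w in A].
Proof.
move=> hinj hj0 hM [[J [q AE]] [w0 Aw0 w00]] d0 OdM.
have iA : invertible A by rewrite AE; apply: ideal_gen_invertible; exists w0 => //; rewrite -AE.
have iB : invertible (PI M).
  apply: ideal_gen_invertible; exists 1; last exact: oner_neq0.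
  have <- : minor M h = 1 by rewrite /minor hM det1.
  exact: minor_in_plucker_ideal.
have [sA [sqA [sqAP sqA1]]] := iA; have [A0 AD AM] := sA.
have [sB [sqB [sqBP sqB1]]] := iB; have [B0 BD BM] := sB.
pose G : set k := [set w | forall b, PI M b -> A (b * w)].
have sG : submod G.
  split=> [b _|u v Gu Gv b Bb|c u Oc Gu b Bb].
  - by rewrite mulr0.
  - by rewrite mulrDr; apply: AD; [exact: Gu|exact: Gv].
  - by rewrite mulrCA; apply: AM => //; exact: Gu.
have iG : invertible G.
  split=> //.
  exists [seq (p.1 * p'.2, p.2 * p'.1) | p <- sqA, p' <- sqB]; split.
    move=> _ /allpairsP[[p p'] /= [/sqAP[Ap Cp] /sqBP[Bp Cp'] ->]] /=; split.
      by move=> b Bb; rewrite mulrCA mulrC; apply: AM => //; exact: Cp'.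
    by move=> w Gw; rewrite mulrA mulrAC [w * _]mulrC; apply: Cp; exact: Gw.
  rewrite big_allpairs_dep -[RHS]sqA1; apply: eq_bigr => p _ /=.
  rewrite -[RHS]mulr1 -sqB1 mulr_sumr; apply: eq_bigr => p' _; ring.
have [y [z [n [y0 z0 n0 H]]]] := invertible_two_generated iG d0.
exists z, n; split => // j t j0_gt x.
have [Gyx [a [b [Oa Ob Oax ab]]]] := H j t j0_gt.
set m : k := (1 + d * n * t)%:R in Gyx Oax *.
have m0 : m != 0 by exact: natk_neq0.
have ym0 : y * m != 0 by rewrite mulf_neq0.
set M' := M + _.
have [sub xsub pl] : [/\ PI M `<=` PI M', forall w, PI M w -> PI M' (x * w) &
      forall I, exists u v, [/\ PI M u, PI M v & plucker M' I = u + x * v]].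
  exact: (@plucker_ideal_perturb _ _ _ M h i0 j0 x a b d).
exists (y * m)^-1; first by rewrite invr_eq0.
have [_ M'D M'M] := submod_ideal_gen (plucker M').
apply/seteqP; split.
  have sP : submod [set w | A (y * m * w)].
    split=> [|u v /= Au Av|c u Oc /= Au]; rewrite /= ?mulr0 ?mulrDr//.
    - exact: AD.
    - by rewrite mulrCA; exact: AM.
  suff h1 : PI M' `<=` [set w | A (y * m * w)].
    by move=> w /h1 /= Aw; exists (y * m * w) => //; rewrite mulKf.
  apply: (ideal_gen_min sP) => I /=; have [u [v [Bu Bv ->]]] := pl I.
  have G1 : G (y * m * 1).
    by apply/Gyx; exists 1, 0; split; [exact: ringint1|exact: ringint0|rewrite mul0r addr0].
  have Gx : G (y * m * x).
    by apply/Gyx; exists 0, 1; split; [exact: ringint0|exact: ringint1|rewrite mul1r add0r].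
  have -> : y * m * (u + x * v) = u * (y * m * 1) + v * (y * m * x) by ring.
  by apply: AD; [exact: G1|exact: Gx].
move=> _ [w Aw <-].
rewrite -[X in PI M' X]mul1r -sqB1 mulr_suml.
apply: submod_sum => [|p /sqBP[Bp Cp]]; first exact: submod_ideal_gen.
have /Gyx [u [v [Ou Ov e]]] : G (y * m * (p.2 * ((y * m)^-1 * w))).
  move=> b' Bb'; have -> : b' * (y * m * (p.2 * ((y * m)^-1 * w))) = b' * p.2 * w.
    by rewrite (mulrCA (y * m)) mulVKf// mulrA.
  by apply: AM => //; exact: Cp.
rewrite -mulrA e.
have -> : p.1 * (u + v * x) = u * p.1 + v * (x * p.1) by ring.
by apply: M'D; apply: M'M; [|exact: sub| |exact: xsub].
Qed.

End ClassPerturbation.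

(** * Affine charts of the Grassmannian over a valued field *)

Section Local.
Variables (R : realType) (K : fieldType) (a : absval R K) (r N : nat).
Local Notation Ka := (abs_space a).

Lemma open_mx_ball (B : set 'M[Ka]_(r, N)) (M : 'M[Ka]_(r, N)) : open B -> B M ->
  exists2 e : R, 0 < e & forall M' : 'M[Ka]_(r, N),
    (forall i j, a (M i j - M' i j) < e) -> B M'.
Proof.
rewrite openE => /[apply]; rewrite /interior -nbhs_ballE => -[e /= e0 eB].
by exists e => // M' H; apply: eB; split => // i j; exact: H.
Qed.

(** The matrix A + t is singular for finitely many t only. *)
Lemma unit_shift (A : 'M[Ka]_r) (e : R) : 0 < e ->
  exists2 t : Ka, a t < e & A + t%:M \in unitmx.
Proof.
move=> e0; have [p p0 pa] := absval_lt1_witness a.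
have pa' : 0 <= a p < 1 by rewrite absval_ge0.
have [n0 _ Hn0] := near_powers_small pa' e0.
pose q := char_poly (- A).
pose s := [seq (p ^+ (n0 + i) : Ka) | i <- iota 0 (size q)].
have us : uniq s.
  have ap0 : 0 < a p by exact: absval_gt0.
  rewrite map_inj_uniq ?iota_uniq// => i j /(congr1 a); rewrite !absvalX.
  by move=> /(ieexprIn ap0 (negbT (lt_eqF pa)))/addnI.
have : ~~ all (root q) s.
  apply/negP => rs.
  have := max_poly_roots (monic_neq0 (char_poly_monic _)) rs us.
  by rewrite size_map size_iota ltnn.
move=> /allPn[t /mapP[i _ tE] nt]; exists t.
  by rewrite tE absvalX; apply: Hn0 => /=; exact: leq_addr.
move: nt; rewrite -eigenvalue_root_char /eigenvalue negbK /eigenspace.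
rewrite kermx_eq0 row_free_unit -opprD.
by rewrite -scaleN1r unitmxZ // unitrN1.
Qed.

(** A point of U is the row space of some matrix M1. Adding to it a small multiple
    of a matrix that is 1 in the columns h makes the minor in these columns
    invertible without leaving U, and then M1 can be normalized. *)
Lemma local_chart (h : 'I_r -> 'I_N) (U : set (grass Ka r N)) :
  injective h -> open U -> U !=set0 ->
  exists T : 'M[Ka]_(r, N), colsub h T = 1%:M /\
  exists2 e : R, 0 < e & forall M : frame Ka r N,
    (forall i j, a (T i j - val M i j) < e) -> U (span_of M).
Proof.
move=> hinj oU [W UW].
have [B oB BE] : exists2 B : set 'M[Ka]_(r, N), open B &
   forall M : frame Ka r N, B (val M) <-> U (span_of M).
  have [B oB BE] := oU; exists B => // M.
  by move: BE => /seteqP[h1 h2]; split=> [/h1|/h2].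
pose M1 := basis_frame W.
have BM1 : B (val M1) by apply/BE; rewrite basis_frameK.
have [e e0 eB] := open_mx_ball oB BM1.
have [t te tu] := unit_shift (colsub h (val M1)) e0.
pose E : 'M[Ka]_(r, N) := \matrix_(i, j) (h i == j)%:R.
pose M2 := val M1 + t *: E.
have M2h : colsub h M2 = colsub h (val M1) + t%:M.
  apply/matrixP => i j; rewrite !mxE (inj_eq hinj).
  by case: eqP => _; rewrite ?mulr1 ?mulr0.
have rf (M : 'M[Ka]_(r, N)) : colsub h M \in unitmx -> M \in [set M | row_free M].
  move=> u; apply/mem_set; apply/row_freeP.
  exists (colsub h 1%:M *m invmx (colsub h M)).
  by rewrite mulmxA mulmx_colsub mulmx1 mulmxV.
have M2u : colsub h M2 \in unitmx by rewrite M2h.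
pose F2 : frame Ka r N := exist (fun M => M \in _) _ (rf M2 M2u).
have UF2 : U (span_of F2).
  apply/BE; apply: eB => i j /=; rewrite !mxE.
  rewrite opprD addrA subrr sub0r absvalN; case: eqP => _; rewrite ?mulr1 ?mulr0//.
  by rewrite absval0.
pose T := invmx (colsub h M2) *m M2.
have Th : colsub h T = 1%:M by rewrite /T -mulmx_colsub mulVmx.
have Tu : colsub h T \in unitmx by rewrite Th unitmx1.
pose FT : frame Ka r N := exist (fun M => M \in _) _ (rf T Tu).
have UT : U (span_of FT).
  rewrite (@span_of_mulmx _ _ _ F2 FT (invmx (colsub h M2)))//.
  by rewrite unitmx_inv.
have /BE BT := UT.
have [e' e'0 e'B] := open_mx_ball oB BT.
by exists T; split => //; exists e' => // M HM; apply/BE/e'B.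
Qed.

End Local.

(** * Subspaces of given class in given open sets *)

Lemma completion_dense (R : realType) (k : fieldType) (a : absval R k)
    (C : completion a) (y : cpl_space C) (e : R) : 0 < e ->
  exists x : k, cpl_abs C (y - cpl_emb C x) < e.
Proof.
move=> e0; pose B : set (abs_space (cpl_abs C)) := [set z | cpl_abs C (y - z) < e].
have oB : open B.
  apply/open_absP => z Bz; exists (e - cpl_abs C (y - z)); first by rewrite subr_gt0.
  move=> z' zz'; rewrite /B /=.
  have -> : y - z' = (y - z) + (z - z') by rewrite addrA subrK.
  apply: le_lt_trans (absval_triangle _ _ _) _.
  by rewrite addrC -ltrBrDr.
have B0 : B !=set0 by exists y; rewrite /B /= subrr absval0.
have [z [Bz [x _ xz]]] := @cpl_dense _ _ _ C B B0 oB.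
by exists x; rewrite xz.
Qed.

Lemma common_bound (R : realType) (I : eqType) (s : seq I) (e : I -> R) :
  (forall i, i \in s -> 0 < e i) ->
  exists2 e', 0 < e' & forall i, i \in s -> e' <= e i.
Proof.
elim: s => [|i s IH] H; first by exists 1.
have [|e' e'0 He'] := IH; first by move=> j js; apply: H; rewrite in_cons js orbT.
exists (Num.min e' (e i)); first by rewrite lt_min e'0 H ?mem_head.
move=> j; rewrite in_cons => /predU1P[->|/He' h]; rewrite ge_min ?lexx ?orbT//.
by rewrite h.
Qed.

Lemma place_inequiv (R : realType) (k : fieldType) (v w : place R k) :
  v != w -> ~~ absval_equiv (repr v) (repr w).
Proof.
by apply: contra => /eqmodP; rewrite !reprK => ->.
Qed.

Theorem theorem1p2 (R : realType) (k : fieldExtType rat) (r N : nat)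
    (hr : (1 <= r)%N) (hrN : (r < N)%N) (c : Cl k)
    (S : {fset place R k})
    (kv : forall v : place R k, completion (repr v))
    (U : forall v : place R k, set (grass (cpl_space (kv v)) r N))
    (hUopen : forall v, v \in S -> open (U v))
    (hUneq0 : forall v, v \in S -> U v !=set0) :
  exists W : grass k r N,
    Psi W = c /\ forall v, v \in S -> U v (grass_map (cpl_emb (kv v)) W).
Proof.
pose s : seq (place R k) := enum_fset S.
pose h : 'I_r -> 'I_N := widen_ord (ltnW hrN).
have hinj : injective h by move=> i j /(congr1 val) /= /val_inj.
pose i0 : 'I_r := Ordinal hr; pose j0 : 'I_N := Ordinal hrN.
have hj0 i : h i != j0 by rewrite -val_eqE /= ltn_eqF.
have local v : exists Te : 'M[cpl_space (kv v)]_(r, N) * R, v \in s ->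
    [/\ colsub h Te.1 = 1%:M, 0 < Te.2 & forall M : frame (cpl_space (kv v)) r N,
      (forall i j, cpl_abs (kv v) (Te.1 i j - val M i j) < Te.2) -> U v (span_of M)].
  have [vs|_] := boolP (v \in s); last by exists (0, 0).
  have [T [Th [e e0 H]]] := local_chart hinj (hUopen v vs) (hUneq0 v vs).
  by exists (T, e).
have [e e0 He] : exists2 e : R, 0 < e & forall v, v \in s -> e <= (projT1 (cid (local v))).2.
  by apply: common_bound => v vs; case: cid => Te /= /(_ vs)[].
pose T v := (projT1 (cid (local v))).1.
have {He} TP v : v \in s -> colsub h (T v) = 1%:M /\
    forall M : frame (cpl_space (kv v)) r N,
      (forall i j, cpl_abs (kv v) (T v i j - val M i j) < e) -> U v (span_of M).
  move=> vs; have := He v vs; rewrite /T; case: cid => Te /= /(_ vs)[Th _ H] eTe.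
  by split => // M HM; apply: H => i j; apply: lt_le_trans (HM i j) eTe.
(* One third of e each for density in the completion, for weak approximation and
   for the correction x. *)
have e3 : 0 < e / 3%:R by rewrite divr_gt0.
have approx ij : exists x : k, forall v, v \in s ->
    cpl_abs (kv v) (T v ij.1 ij.2 - cpl_emb (kv v) x) < e / 3%:R + e / 3%:R.
  have [t tP] := choice (fun v => completion_dense (T v ij.1 ij.2) e3).
  have [|x xP] := @weak_approximation R k _ (fun v : place R k => repr v) s t _ (fset_uniq S) e3.
    by move=> v w _ _; exact: place_inequiv.
  exists x => v vs.
  have -> : T v ij.1 ij.2 - cpl_emb (kv v) x =
      (T v ij.1 ij.2 - cpl_emb (kv v) (t v)) + (cpl_emb (kv v) (t v - x)).
    by rewrite rmorphB addrA subrK.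
  apply: le_lt_trans (absval_triangle _ _ _) _; apply: ltrD => //.
  by rewrite cpl_embE -absvalN opprB; exact: xP.
have [T0 T0P] := choice approx.
pose M0 : 'M[k]_(r, N) := \matrix_(i, j)
  if (j < r)%N then (h i == j)%:R else T0 (i, j).
have M0h : colsub h M0 = 1%:M.
  by apply/matrixP => i j; rewrite !mxE /= ltn_ord (inj_eq hinj).
(* d clears the denominators of the minors and is small at the nonarchimedean
   places of S. *)
have [d1 d1_gt0 Hd1] := common_denominator (plucker M0).
have [d [d_gt0 dd1 Hd]] := common_small_nat [seq repr v | v <- s] d1_gt0.
have OdM0 I : ring_of_integers (d%:R * plucker M0 I).
  move/dvdnP: dd1 => [q ->]; rewrite natrM -mulrA; apply: ringintM; [exact: ringint_nat|exact: Hd1].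
have /asboolP fA := valP (repr c).
have [z [n [n_gt0 Hcl]]] := @class_perturbation k r N M0 h i0 j0 _ d hinj hj0 M0h fA d_gt0 OdM0.
have [j [t [j_gt0 small]]] := small_ratio z d_gt0 n_gt0 e3 Hd.
have /= [l l0 PIE] := Hcl j t j_gt0.
set x := _ / _ in small PIE.
set M := M0 + _ in PIE.
have Mh : colsub h M = 1%:M.
  rewrite -M0h; apply/matrixP => i i'; rewrite !mxE (negbTE (hj0 i')) andbF.
  by rewrite mulr0 addr0.
have Mfree : M \in [set M | row_free M].
  apply/mem_set; apply/row_freeP; exists (colsub h 1%:M).
  by rewrite mulmx_colsub mulmx1.
pose F : frame k r N := exist (fun M => M \in _) _ Mfree.
exists (span_of F); split.
  rewrite Psi_span -[c]reprK; apply/eqmodP/asboolP; exists l^-1.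
    by rewrite invr_eq0.
  rewrite /= PIE image_comp; apply/seteqP; split=> [w Aw|_ [w Aw <-]] /=.
    by exists w => //=; rewrite mulKf.
  by rewrite mulKf.
move=> v vs; rewrite grass_map_span; have [Th TU] := TP v vs.
apply: TU => i i'; rewrite /= mxE.
have [i'r|ri'] := ltnP i' r.
  have i'E : i' = h (Ordinal i'r) by exact: val_inj.
  have -> : T v i i' = (i == Ordinal i'r)%:R.
    by move/matrixP/(_ i (Ordinal i'r)): Th; rewrite !mxE -i'E.
  have -> : M i i' = (i == Ordinal i'r)%:R.
    by move/matrixP/(_ i (Ordinal i'r)): Mh; rewrite !mxE -i'E.
  by rewrite rmorph_nat subrr absval0.
have -> : M i i' = T0 (i, i') + x * ((i == i0) && (i' == j0))%:R.
  by rewrite !mxE ltnNge ri'.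
rewrite rmorphD opprD addrA.
apply: le_lt_trans (absval_triangle _ _ _) _; rewrite absvalN cpl_embE.
have -> : e = (e / 3%:R + e / 3%:R) + e / 3%:R by field.
apply: ltrD; first exact: (T0P (i, i')).
case: (_ && _); rewrite ?mulr1 ?mulr0 ?absval0//.
by apply: small; apply: map_f.
Qed.
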